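(* Let $(\mathcal C,\delta)$ be a $C^*$-dynamical system with $\mathcal C\neq 0$, let $A:\mathcal C\to\mathcal C$ be a transfer operator for $(\mathcal C,\delta)$, and let $A_\varphi=A(e^{\varphi}\,\cdot\,)$ for all $\varphi\in\mathcal C$. Then the corresponding spectral potential $\lambda(\varphi)$ satisfies $$\lambda(\varphi)=\max_{\mu\in M_\delta(\mathcal C)}\bigl(\mu(\varphi)+\tau(\mu)\bigr),\qquad \varphi\in\mathcal C,$$ where $M_\delta(\mathcal C)$ is the set of all positive normalized $\delta$-invariant linear functionals on $\mathcal C$ and $\tau$ is the $t$-entropy.
   Context: A base algebra $\mathcal C$ is the selfadjoint part $\{b\in\mathcal B: b^*=b\}$ of a commutative $C^*$-algebra $\mathcal B$ with identity $\mathbf 1$; via the Gelfand transform $\mathcal C\cong C(X)$, the real-valued continuous functions on the compact Hausdorff maximal ideal space $X$. A $C^*$-dynamical system is a pair $(\mathcal C,\delta)$ with $\mathcal C$ a base algebra and $\delta:\mathcal C\to\mathcal C$ an endomorphism with $\delta(\mathbf 1)=\mathbf 1$. A linear operator $A:\mathcal C\to\mathcal C$ is a transfer operator for $(\mathcal C,\delta)$ if it is positive (maps nonnegative elements to nonnegative elements) and $A\bigl((\delta f)g\bigr)=fAg$ for all $f,g\in\mathcal C$. The spectral potential is $$\lambda(\varphi)=\lim_{n\to\infty}\frac1n\ln\|A_\varphi^n\mathbf 1\|\in[-\infty,\infty),\qquad A_\varphi f=A(e^\varphi f),\qquad \ln0=-\infty.$$ $M(\mathcal C)$ is the set of positive linear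 functionals $\mu$ on $\mathcal C$ with $\mu(\mathbf 1)=1$; $M_\delta(\mathcal C)$ is the set of $\mu\in M(\mathcal C)$ with $\mu(\delta f)=\mu(f)$ for all $f\in\mathcal C$. A partition of unity in $\mathcal C$ is a finite set $D=\{g_1,\dots,g_k\}$ of nonnegative elements with $g_1+\dots+g_k=\mathbf 1$. For $\mu\in M_\delta(\mathcal C)$ the $t$-entropy is $$\tau(\mu):=\inf_{n\in\mathbb N}\frac{\tau_n(\mu)}{n},\qquad \tau_n(\mu):=\inf_D\tau_n(\mu,D),\qquad \tau_n(\mu,D):=\sup_{m\in M(\mathcal C)}\sum_{g\in D}\mu(g)\ln\frac{m(A^ng)}{\mu(g)},$$ the infimum being over all partitions of unity $D$ in $\mathcal C$; a summand with $\mu(g)=0$ is set to be zero regardless of $m(A^ng)$; and if for some $g\in D$ one has $A^ng=0$ and $\mu(g)>0$, then $\tau(\mu)=-\infty$ (consistently with $\ln0=-\infty$). *)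

(* Defs.v *)
From HB Require Import structures.
From mathcomp Require Import all_boot all_order all_algebra.
From mathcomp Require Import finmap.
From mathcomp Require Import complex.
From mathcomp Require Import all_classical all_reals all_analysis.

Set Implicit Arguments.
Unset Strict Implicit.
Unset Printing Implicit Defensive.

Import Order.TTheory GRing.Theory Num.Theory.
Import numFieldNormedType.Exports.

Local Open Scope classical_set_scope.
Local Open Scope complex_scope.
Local Open Scope ring_scope.

(* Commutative C*-algebras with identity.  ComAlgebra requires 1 != 0, so the
   zero algebra is excluded.  The norm is real-valued; it is a field of the
   structure because the library has no class joining rings and normed modules
   other than those of number domains.  Its nonnegativity follows from the
   triangle inequality and homogeneity. *)
HB.mixin Record isComCStarAlgebra (R : realType) B
    of GRing.ComAlgebra R[i] B := {
  star : B -> B ;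
  starK : involutive star ;
  starD : {morph star : a b / a + b} ;
  starZ : forall (z : R[i]) (a : B), star (z *: a) = z^*%C *: star a ;
  starM : forall a b : B, star (a * b) = star b * star a ;
  cnorm : B -> R ;
  cnormD : forall a b : B, cnorm (a + b) <= cnorm a + cnorm b ;
  cnormZ : forall (z : R[i]) (a : B),
    cnorm (z *: a) = complex.Re `|z| * cnorm a ;
  cnorm0_eq0 : forall a : B, cnorm a = 0 -> a = 0 ;
  cnormM : forall a b : B, cnorm (a * b) <= cnorm a * cnorm b ;
  cnorm_complete : forall u : nat -> B,
    (forall e : R, 0 < e -> exists N : nat, forall m n : nat,
       (N <= m)%N -> (N <= n)%N -> cnorm (u m - u n) < e) ->
    exists l : B, forall e : R, 0 < e -> exists N : nat, forall n : nat,
       (N <= n)%N -> cnorm (u n - l) < e ;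
  cnorm_cstar : forall a : B, cnorm (star a * a) = cnorm a ^+ 2
}.

#[short(type="comCStarAlgType")]
HB.structure Definition ComCStarAlgebra (R : realType) :=
  {B of GRing.ComAlgebra R[i] B & isComCStarAlgebra R B}.

Section SelfAdjointPred.
Context (R : realType) (B : comCStarAlgType R).

Definition is_selfadj : {pred B} := fun b => star b == b.

Lemma star0 : star 0 = 0 :> B.
Proof. by apply: (addrI (star 0)); rewrite -starD !addr0. Qed.

Lemma starN (a : B) : star (- a) = - star a.
Proof. by apply: (addrI (star a)); rewrite -starD !subrr star0. Qed.

Lemma star1 : star 1 = 1 :> B.
Proof. by rewrite -[LHS]mulr1 -[X in _ * X]starK -starM mulr1 starK. Qed.

Lemma is_selfadj_subring : subring_closed is_selfadj.
Proof.
split=> [|a b|a b]; rewrite !unfold_in ?star1 // => /eqP ha /eqP hb.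
  by rewrite starD starN ha hb.
by rewrite starM ha hb mulrC.
Qed.

HB.instance Definition _ :=
  GRing.isSubringClosed.Build B is_selfadj is_selfadj_subring.

End SelfAdjointPred.

(* The base algebra: the selfadjoint part of B, as a real normed algebra. *)
Record selfadj (R : realType) (B : comCStarAlgType R) :=
  SelfAdj { selfadj_val :> B ; _ : selfadj_val \in @is_selfadj R B }.

Section SelfAdjoint.
Context (R : realType) (B : comCStarAlgType R).
Local Notation C := (selfadj B).

HB.instance Definition _ := [isSub for @selfadj_val R B].
HB.instance Definition _ := [Choice of C by <:].
HB.instance Definition _ := [SubChoice_isSubComNzRing of C by <:].

Fact selfadj_scale_subproof (r : R) (x : C) :
  r%:C *: (val x) \in @is_selfadj R B.
Proof.
by have /eqP hx := valP x; rewrite unfold_in starZ conjc_real hx.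
Qed.

Definition selfadj_scale (r : R) (x : C) : C :=
  SelfAdj (selfadj_scale_subproof r x).

Fact selfadj_scaleA (a b : R) (v : C) :
  selfadj_scale a (selfadj_scale b v) = selfadj_scale (a * b) v.
Proof. by apply: val_inj; rewrite /= scalerA rmorphM. Qed.

Fact selfadj_scale1 : left_id 1 selfadj_scale.
Proof. by move=> v; apply: val_inj; rewrite /= scale1r. Qed.

Fact selfadj_scaleDr : right_distributive selfadj_scale +%R.
Proof. by move=> a u v; apply: val_inj; rewrite /= scalerDr. Qed.

Fact selfadj_scaleDl (v : C) : {morph selfadj_scale^~ v : a b / a + b}.
Proof. by move=> a b; apply: val_inj; rewrite /= rmorphD scalerDl. Qed.

HB.instance Definition _ := GRing.Zmodule_isLmodule.Build R C
  selfadj_scaleA selfadj_scale1 selfadj_scaleDr selfadj_scaleDl.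

Fact selfadj_scaleAl (a : R) (u v : C) : a *: (u * v) = (a *: u) * v.
Proof. by apply: val_inj; rewrite /= scalerAl. Qed.

HB.instance Definition _ :=
  GRing.Lmodule_isLalgebra.Build R C selfadj_scaleAl.
HB.instance Definition _ := GRing.Lalgebra_isComAlgebra.Build R C.

Definition selfadj_norm (x : C) : R := cnorm (val x).

Fact selfadj_normD (x y : C) :
  selfadj_norm (x + y) <= selfadj_norm x + selfadj_norm y.
Proof. exact: cnormD. Qed.

Fact selfadj_normZ (r : R) (x : C) :
  selfadj_norm (r *: x) = `|r| * selfadj_norm x.
Proof. by rewrite /selfadj_norm cnormZ normc_def/= expr0n addr0 sqrtr_sqr. Qed.

Fact selfadj_norm0 (x : C) : selfadj_norm x = 0 -> x = 0.
Proof. by move=> h; apply/val_inj/cnorm0_eq0. Qed.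

HB.instance Definition _ := Lmodule_isNormed.Build R C
  selfadj_normD selfadj_normZ selfadj_norm0.

End SelfAdjoint.

Section TEntropy.
Context (R : realType) (B : comCStarAlgType R).
Local Notation C := (selfadj B).

(* Positive elements of a C*-algebra are those of the form b^* b; under the
   Gelfand transform they are the nonnegative functions. *)
Definition nonneg (f : C) : Prop := exists b : B, val f = star b * b.

Definition transfer_operator (delta : {lrmorphism C -> C})
    (A : {linear C -> C}) : Prop :=
  (forall f, nonneg f -> nonneg (A f)) /\
  (forall f g, A (delta f * g) = f * A g).

(* The exponential series, converging in the norm of C. *)
Definition expC (phi : C) : C :=
  limn (series (fun k => (k`!%:R : R)^-1 *: phi ^+ k)).

Definition weighted (A : {linear C -> C}) (phi : C) (f : C) : C :=
  A (expC phi * f).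

Local Open Scope ereal_scope.

(* The library's lne satisfies lne 0 = -oo; the value at n = 0 is irrelevant for the limit. *)
Definition spectral_seq (A : {linear C -> C}) (phi : C) (n : nat) : \bar R :=
  (n%:R^-1)%:E * lne (`|iter n (weighted A phi) 1%R|)%:E.

Definition spectral_potential (A : {linear C -> C}) (phi : C) : \bar R :=
  limn (spectral_seq A phi).

Definition states : set {scalar C} :=
  [set mu | (forall f, nonneg f -> (0 <= mu f)%R) /\ mu 1%R = 1%R].

Definition invariant_states (delta : {lrmorphism C -> C}) : set {scalar C} :=
  [set mu | states mu /\ forall f, mu (delta f) = mu f].

Definition partition_of_unity : set {fset C} :=
  [set D : {fset C} | (forall g, g \in D -> nonneg g) /\ (\sum_(g <- D) g = 1)%R].

(* If mu g > 0 and A^n g = 0 the summand is -oo for every m. *)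
Definition tau_summand (A : {linear C -> C}) (n : nat) (mu m : {scalar C})
    (g : C) : \bar R :=
  if mu g == 0%R then 0 else (mu g)%:E * lne (m (iter n A g) / mu g)%:E.

Definition tau_part (A : {linear C -> C}) (n : nat) (mu : {scalar C})
    (D : {fset C}) : \bar R :=
  ereal_sup [set \sum_(g <- D) tau_summand A n mu m g | m in states].

Definition tau_n (A : {linear C -> C}) (n : nat) (mu : {scalar C}) : \bar R :=
  ereal_inf [set tau_part A n mu D | D in partition_of_unity].

Definition t_entropy (A : {linear C -> C}) (mu : {scalar C}) : \bar R :=
  ereal_inf [set (n%:R^-1)%:E * tau_n A n mu | n in [set n | (0 < n)%N]].

Definition is_max (S : set (\bar R)) (x : \bar R) : Prop :=
  S x /\ ubound S x.

End TEntropy.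

(* Main.v *)
(* Self-adjoint elements are handled through the characters of the base algebra
   C: order and norm are pointwise there, so every inequality in C reduces to one
   between real numbers.  Write W = A_phi, S_n = phi + ... + delta^(n-1) phi, so
   that W^n f = A^n (e^(S_n) f), and h_i = W^i 1; by submultiplicativity lambda is
   the infimum of ln |h_n| / n.

   Upper bound: along the Bernstein partitions (g_j) attached to S_n, with nodes
   c_j, the tangent inequality x ln (y/x) <= x ln a + y/a - x at a = k e^(-c_j)
   gives tau_n(mu) <= ln k - n mu(phi) for every k > |h_n|.

   Attainment: take characters m_N with m_N(h_N) > |h_N|/2, put
   nu_N(f) = m_N(W^N f) / m_N(h_N), and let mu be an ultrafilter limit of the
   averages of nu_N o delta^i over i < N.  The supremum in tau_n(mu, D) is then
   large enough already at m = mu.  Indeed, the summands are infima over a > 0 of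
   expressions linear in mu, so it suffices to bound these from below for nu_N
   o delta^i; there they dominate a difference of the quantities
   nu_N(delta^i ln (h_i + e)), and the sum over i telescopes. *)

Require Import Defs.
From HB Require Import structures.
From mathcomp Require Import all_boot all_order all_algebra.
From mathcomp Require Import finmap complex.
From mathcomp Require Import all_classical all_reals all_analysis.
From mathcomp Require Import ring lra.
Import Order.TTheory GRing.Theory Num.Theory.
Import numFieldNormedType.Exports.
Local Open Scope classical_set_scope.
Local Open Scope ring_scope.

Set Implicit Arguments.
Unset Strict Implicit.
Unset Printing Implicit Defensive.

(** * The positive cone *)

Section CStarNorm.
Context (R : realType) (B : comCStarAlgType R).
Local Notation C := (selfadj B).
Implicit Types (a : B) (f g u v x : C).

Lemma cnorm_ge0 a : 0 <= cnorm a.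
Proof.
have h0 : cnorm (0 : B) = 0.
  by rewrite -[X in cnorm X](scale0r a) cnormZ normr0 mul0r.
have hN : cnorm (- a) = cnorm a.
  by rewrite -scaleN1r cnormZ normrN1 mul1r.
have := cnormD a (- a); rewrite subrr h0 hN; lra.
Qed.

(** Cancel [cnorm b] in [|b|^2 = |star b * b| <= |star b| |b|], then exchange [b] and [star b]. *)
Lemma cnorm_star a : cnorm (star a) = cnorm a.
Proof.
suff H (b : B) : cnorm b <= cnorm (star b).
  by apply: le_anti; rewrite H andbT -{2}[a]starK H.
have [->|b0] := eqVneq (cnorm b) 0; first exact: cnorm_ge0.
have bp : 0 < cnorm b by rewrite lt_def b0 cnorm_ge0.
by rewrite -(ler_pM2r bp) -expr2 -cnorm_cstar cnormM.
Qed.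

Lemma cnorm1 : cnorm (1 : B) = 1.
Proof.
have h := cnorm_cstar (1 : B); rewrite star1 mulr1 in h.
have n0 : cnorm (1 : B) != 0.
  by apply/eqP => /cnorm0_eq0 /eqP; rewrite oner_eq0.
by apply: (mulIf n0); rewrite mul1r -expr2 -h.
Qed.

Lemma normE x : `|x| = cnorm (val x).
Proof. by []. Qed.

Lemma selfadj_norm1 : `|1 : C| = 1.
Proof. by rewrite normE cnorm1. Qed.

Lemma selfadj_normM f g : `|f * g| <= `|f| * `|g|.
Proof. exact: cnormM. Qed.

(** The involution is isometric, so a limit in [B] of self-adjoint elements is self-adjoint and [C]
    inherits completeness. *)
Lemma selfadj_cauchy_cvg (w : nat -> C) :
  (forall e : R, 0 < e -> exists N : nat, forall m n : nat,
       (N <= m)%N -> (N <= n)%N -> `|w m - w n| < e) ->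
  exists l : C, forall e : R, 0 < e -> exists N : nat, forall n : nat,
       (N <= n)%N -> `|w n - l| < e.
Proof.
move=> hw; have [l hl] := @cnorm_complete R B (fun n => val (w n)) hw.
suff sl : l \in @is_selfadj R B by exists (SelfAdj sl).
rewrite unfold_in; apply/eqP/subr0_eq/cnorm0_eq0/le_anti.
rewrite cnorm_ge0 andbT; apply/ler_addgt0Pr => e e0; rewrite add0r.
have [N hN] := hl (e / 2) (divr_gt0 e0 (ltr0Sn _ 1)).
have h := hN N (leqnn N).
have hs : star (val (w N)) = val (w N) by apply/eqP; exact: (valP (w N)).
rewrite (_ : star l - l = star (- (val (w N) - l)) + (val (w N) - l)).
  apply: le_trans (cnormD _ _) _.
  rewrite cnorm_star -scaleN1r cnormZ normrN1 mul1r; lra.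
by rewrite opprB starD starN hs; ring.
Qed.

(* Take the norm of the unitary multiple [u + i v] of [c]. *)
Lemma norm_le_sumsqr (c : R) u v :
  0 <= c -> u ^+ 2 + v ^+ 2 = (c ^+ 2)%:A -> `|u| <= c.
Proof.
move=> c0 h; pose i : R[i] := 'i.
pose z := val u + i *: val v.
have us : star (val u) = val u by apply/eqP; exact: (valP u).
have vs : star (val v) = val v by apply/eqP; exact: (valP v).
have iC : (i^*)%C = - i by rewrite /i; apply/eqP; rewrite eq_complex /= oppr0 !eqxx.
have zs : star z = val u - i *: val v.
  by rewrite /z starD starZ us vs iC scaleNr.
have ii : i * i = -1 by rewrite -expr2 sqr_i.
have zz : star z * z = val (u ^+ 2 + v ^+ 2).
  rewrite zs /z /= mulrDr !mulrDl.
  rewrite !mulNr -!scalerAl -!scalerAr scalerA ii scaleN1r opprK.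
  rewrite (mulrC (val v)); move: (i *: _) => X; by ring.
have : cnorm z ^+ 2 = c ^+ 2.
  rewrite -cnorm_cstar zz h /= cnormZ cnorm1 mulr1 normc_def/= expr0n addr0.
  by rewrite sqrtr_sqr ger0_norm // exprn_ge0.
move=> /eqP; rewrite eqrXn2 ?cnorm_ge0 // => /eqP zc.
have : `|u + u| <= c + c.
  rewrite normE (_ : val (u + u) = z + star z); last first.
    by rewrite zs /z /=; ring.
  by apply: le_trans (cnormD _ _) _; rewrite cnorm_star zc.
by rewrite -mulr2n -scaler_nat normrZ gtr0_norm //; lra.
Qed.

(** [u] is the real part of [b] and [v] is minus its imaginary part; by commutativity the mixed
    terms cancel. *)
Lemma nonneg_sumsqr f : nonneg f -> exists u v, f = u ^+ 2 + v ^+ 2.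
Proof.
case=> b fb; pose i : R[i] := 'i; pose h : R[i] := (2^-1)%:C%C.
have iC : (i^*)%C = - i by rewrite /i; apply/eqP; rewrite eq_complex /= oppr0 !eqxx.
have hC : (h^*)%C = h by rewrite conjc_real.
have ii : i * i = -1 by rewrite -expr2 sqr_i.
have us : h *: (b + star b) \in @is_selfadj R B.
  by rewrite unfold_in starZ starD starK hC addrC.
have vs : (i * h) *: (b - star b) \in @is_selfadj R B.
  have ihC : ((i * h)^*)%C = - (i * h).
    have -> : ((i * h)^*)%C = (i^*)%C * (h^*)%C by exact: rmorphM.
    by rewrite iC hC mulNr.
  by rewrite unfold_in starZ starD starN starK ihC scaleNr -scalerN opprB.
exists (SelfAdj us), (SelfAdj vs); apply: val_inj; rewrite fb !expr2 /=.
rewrite -!scalerAl -!scalerAr !scalerA.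
have hh : h * h = (4^-1)%:C%C by rewrite -rmorphM /=; congr (_%:C%C); field.
rewrite hh (_ : i * h * (i * h) = - (4^-1)%:C%C); last first.
  by rewrite mulrACA ii hh mulN1r.
rewrite scaleNr -scalerBr.
rewrite (_ : _ - _ = (4 : R)%:C%C *: (star b * b)).
  by rewrite scalerA -rmorphM /= mulVf ?rmorph1 ?scale1r // pnatr_eq0.
by rewrite rmorph_nat scaler_nat; ring.
Qed.

Lemma sqr_nonneg f : nonneg (f ^+ 2).
Proof.
by exists (val f); have /eqP -> : star (val f) == val f := valP f.
Qed.

End CStarNorm.

(** * Square roots near the identity *)

Section SquareRoot.
Context (R : realType) (B : comCStarAlgType R).
Local Notation C := (selfadj B).
Implicit Types (f g u v x : C).

Let r (n : nat) : R := iter n (fun s => (1 + s ^+ 2) / 2) 0.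
(** A fixed point of [s -> (x + s^2) / 2] is exactly a solution of [(1 - s)^2 = 1 - x]. *)
Let y x (n : nat) : C := iter n (fun s => 2^-1 *: (x + s ^+ 2)) 0.

Let r01 n : 0 <= r n <= 1.
Proof. by elim: n => [|n /= IH]; [rewrite /= lexx ler01|nra]. Qed.

Let y_dist x : `|x| <= 1 -> forall n k,
  `|y x n| <= r n /\ `|y x (n + k) - y x n| <= r (n + k)%N - r n.
Proof.
move=> x1.
have yr n : `|y x n| <= r n.
  elim: n => [|n IH] /=; first by rewrite normr0.
  rewrite normrZ gtr0_norm ?invr_gt0 // mulrC ler_pM2r ?invr_gt0 //.
  apply: le_trans (ler_normD _ _) _; apply: lerD => //.
  rewrite !expr2; apply: le_trans (selfadj_normM _ _) _.
  by apply: ler_pM.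
move=> n k; split => //.
elim: n => [|n IH]; first by rewrite /= !subr0.
rewrite addSn /= -scalerBr normrZ gtr0_norm ?invr_gt0 //.
have -> : x + y x (n + k) ^+ 2 - (x + y x n ^+ 2) =
  (y x (n + k) - y x n) * (y x (n + k) + y x n) by ring.
have -> : (1 + r (n + k)%N ^+ 2) / 2 - (1 + r n ^+ 2) / 2 =
   2^-1 * ((r (n + k)%N - r n) * (r (n + k)%N + r n)) by ring.
rewrite ler_pM2l ?invr_gt0 //.
apply: le_trans (selfadj_normM _ _) _; apply: ler_pM => //.
by apply: le_trans (ler_normD _ _) _; apply: lerD.
Qed.

(* The iteration [s -> (x + s^2) / 2] is dominated, increment by increment, by
   the same real iteration started with [x = 1], which is bounded by 1. *)
Lemma sqrt1B x : `|x| <= 1 -> exists2 s : C, `|s| <= 1 & (1 - s) ^+ 2 = 1 - x.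
Proof.
move=> x1; have yd := y_dist x1.
have hs : has_sup (range r).
  split; first by exists (r 0%N), 0%N.
  by exists 1 => _ [n _ <-]; case/andP: (r01 n).
have rmono n k : r n <= r (n + k)%N.
  by have [_ h] := yd n k; rewrite -subr_ge0; exact: le_trans (normr_ge0 _) h.
(* Beyond an index where [r] is within [e] of its supremum, the monotone [r] moves by less than [e],
   and so does [y x]. *)
have rc e : 0 < e -> exists N, forall n, (N <= n)%N -> `|y x n - y x N| < e.
  move=> e0; have [_ [N _ <-] hN] := sup_adherent e0 hs.
  exists N => n /subnKC <-; have [_ h] := yd N (n - N)%N.
  apply: le_lt_trans h _; rewrite ltrBlDl.
  rewrite -ltrBlDr; apply: le_lt_trans hN; rewrite lerB //.
  by apply: ub_le_sup; [case: hs|exists (N + (n - N))%N].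
have [l hl] : exists l : C, forall e : R, 0 < e -> exists N : nat, forall n : nat,
       (N <= n)%N -> `|y x n - l| < e.
  apply: selfadj_cauchy_cvg => e e0; have [N hN] := rc (e / 2) (divr_gt0 e0 (ltr0Sn _ 1)).
  exists N => m n /hN hm /hN hn.
  rewrite (_ : y x m - y x n = (y x m - y x N) - (y x n - y x N)); last by ring.
  by apply: le_lt_trans (ler_normB _ _) _; lra.
have l1 : `|l| <= 1.
  apply/ler_addgt0Pr => e /hl [N /(_ N (leqnn N)) h].
  rewrite -[l](subKr (y x N)).
  apply: le_trans (ler_normB _ _) _; apply: lerD; last exact: ltW.
  by have [h1 _] := yd N 0%N; apply: le_trans h1 _; case/andP: (r01 N).
exists l => //.
have E : l = 2^-1 *: (x + l ^+ 2).
  apply/eqP; rewrite -subr_eq0 -normr_le0; apply/ler_addgt0Pr => e e0.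
  rewrite add0r; have [N hN] := hl (e / 2) (divr_gt0 e0 (ltr0Sn _ 1)).
  have h0 := hN N (leqnn N); have h1 := hN N.+1 (leqnSn N).
  have -> : l - 2^-1 *: (x + l ^+ 2) =
     2^-1 *: ((y x N - l) * (y x N + l)) - (y x N.+1 - l).
    rewrite [y x N.+1]/= -!/(y x N).
    have -> : (y x N - l) * (y x N + l) = (x + y x N ^+ 2) - (x + l ^+ 2) by ring.
    rewrite scalerBr; move: (_ *: _) (_ *: _) => X Y; by ring.
  apply: le_trans (ler_normB _ _) _; rewrite normrZ gtr0_norm ?invr_gt0 //.
  have h2 : `|(y x N - l) * (y x N + l)| <= e / 2 * 2.
    apply: le_trans (selfadj_normM _ _) _; apply: ler_pM => //; first exact: ltW.
    apply: le_trans (ler_normD _ _) _.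
    have [h3 _] := yd N 0%N; have /andP[_ h4] := r01 N.
    have := le_trans h3 h4; lra.
  lra.
have E2 : 2 * l = x + l ^+ 2.
  by rewrite {1}E mulr_natl -scaler_nat scalerA divff ?scale1r ?pnatr_eq0.
rewrite (_ : 1 - x = 1 - 2 * l + l ^+ 2); first by ring.
by rewrite E2; ring.
Qed.

End SquareRoot.

(** * Positivity described by the norm *)

Section PositiveCone.
Context (R : realType) (B : comCStarAlgType R).
Local Notation C := (selfadj B).
Implicit Types (f g u v x : C) (t : R).

(** With [1 - f^2 = (1 - s)^2] one has [(1 - s)^2 + f^2 = 1], so [norm_le_sumsqr] bounds [1 - s]. *)
Lemma norm_sqrB1 f : `|f| <= 1 -> `|1 - f ^+ 2| <= 1.
Proof.
move=> f1; have f2 : `|f ^+ 2| <= 1.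
  rewrite expr2; apply: le_trans (selfadj_normM _ _) _.
  by rewrite -[leRHS]mulr1; apply: ler_pM.
have [s s1 hs] := sqrt1B f2.
rewrite -hs expr2; apply: le_trans (selfadj_normM _ _) _.
have h : `|1 - s| <= 1.
  apply: (@norm_le_sumsqr _ _ 1 _ f) => //.
  by rewrite hs expr1n scale1r subrK.
by rewrite -[leRHS]mulr1; apply: ler_pM.
Qed.

Lemma norm_alg (r : R) : `|r%:A : C| = `|r|.
Proof. by rewrite normrZ selfadj_norm1 mulr1. Qed.

(** The condition [|t - f| <= t] describes positivity by the norm: divided by [t], it puts [f / t]
    within 1 of the identity, where [sqrt1B] gives a root. The root satisfies a condition of the
    same kind, hence is itself nonnegative. *)
Lemma dist_sqrt f t : `|t%:A - f| <= t ->
  exists s : C, f = s ^+ 2 /\ exists c : R, `|c%:A - s| <= c.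
Proof.
move=> h; have t0 : 0 <= t := le_trans (normr_ge0 _) h.
have [t00|tn0] := eqVneq t 0.
  exists 0; move: h; rewrite t00 scale0r sub0r normrN normr_le0 => /eqP ->.
  by rewrite expr0n; split=> //; exists 0; rewrite scale0r subr0 normr0.
have tp : 0 < t by rewrite lt_def tn0.
have x1 : `|1 - t^-1 *: f| <= 1.
  rewrite -(ler_pM2l tp) mulr1; apply: le_trans h.
  by rewrite -{1}(gtr0_norm tp) -normrZ scalerBr scalerA divff // scale1r.
have [s s1 hs] := sqrt1B x1.
exists (Num.sqrt t *: (1 - s)); split.
  by rewrite exprZn sqr_sqrtr // hs opprB addrC subrK scalerA divff // scale1r.
exists (Num.sqrt t); rewrite -scalerBr normrZ ger0_norm ?sqrtr_ge0 //.
by rewrite opprB addrC subrK ler_piMr ?sqrtr_ge0.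
Qed.

Lemma dist_nonneg f t : `|t%:A - f| <= t -> nonneg f.
Proof. by move=> /dist_sqrt [s [-> _]]; exact: sqr_nonneg. Qed.

Lemma sqr_dist u : `|(`|u| ^+ 2)%:A - u ^+ 2| <= `|u| ^+ 2.
Proof.
have [->|u0] := eqVneq u 0.
  by rewrite normr0 !expr0n scale0r subrr normr0.
have up : 0 < `|u| by rewrite normr_gt0.
have h : `| `|u|^-1 *: u| <= 1.
  by rewrite normrZ ger0_norm ?invr_ge0 // mulVf // gt_eqF.
have := norm_sqrB1 h; rewrite -(ler_pM2l (exprn_gt0 2 up)) mulr1.
rewrite -[X in X * _](ger0_norm (exprn_ge0 2 (ltW up))) -normrZ scalerBr.
by rewrite exprZn scalerA exprVn divff ?scale1r // expf_eq0 /= gt_eqF.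
Qed.

(** The norm condition is additive, the radii [t] adding up, so it passes from squares to sums of
    squares. *)
Lemma nonneg_dist f : nonneg f -> exists t : R, `|t%:A - f| <= t.
Proof.
move=> /nonneg_sumsqr [u [v ->]]; exists (`|u| ^+ 2 + `|v| ^+ 2).
rewrite scalerDl opprD addrACA.
by apply: le_trans (ler_normD _ _) _; apply: lerD; exact: sqr_dist.
Qed.

Lemma nonneg_sqrt f : nonneg f -> exists s : C, f = s ^+ 2 /\ nonneg s.
Proof.
move=> /nonneg_dist [t /dist_sqrt [s [fs [c hc]]]].
by exists s; split => //; exact: dist_nonneg hc.
Qed.

Lemma nonnegD f g : nonneg f -> nonneg g -> nonneg (f + g).
Proof.
move=> /nonneg_dist [s hs] /nonneg_dist [t ht].
apply: (@dist_nonneg _ (s + t)); rewrite scalerDl opprD addrACA.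
by apply: le_trans (ler_normD _ _) _; apply: lerD.
Qed.

Lemma nonnegM f g : nonneg f -> nonneg g -> nonneg (f * g).
Proof.
move=> /nonneg_sqrt [s [-> _]] /nonneg_sqrt [t [-> _]].
by rewrite -exprMn; exact: sqr_nonneg.
Qed.

Lemma nonneg_alg t : 0 <= t -> nonneg (t%:A : C).
Proof.
by move=> t0; apply: (@dist_nonneg _ t); rewrite subrr normr0.
Qed.

Lemma nonneg0 : nonneg (0 : C).
Proof. by rewrite -(scale0r 1); exact: nonneg_alg. Qed.

Lemma nonneg1 : nonneg (1 : C).
Proof. by rewrite -(scale1r 1); exact: nonneg_alg. Qed.

Lemma nonnegZ t f : 0 <= t -> nonneg f -> nonneg (t *: f).
Proof. by move=> t0 hf; rewrite -mulr_algl; apply: nonnegM => //; exact: nonneg_alg. Qed.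

Lemma le_norm f t : `|f| <= t -> nonneg (t%:A - f).
Proof. by move=> h; apply: (@dist_nonneg _ t); rewrite subKr. Qed.

(** If [t - f = u^2] and [t + f = v^2], then [f^2 + (u v)^2 = t^2]. *)
Lemma norm_le f t : 0 <= t -> nonneg (t%:A - f) -> nonneg (t%:A + f) -> `|f| <= t.
Proof.
move=> t0 /nonneg_sqrt [u [hu _]] /nonneg_sqrt [v [hv _]].
apply: (@norm_le_sumsqr _ _ t _ (u * v)) => //.
rewrite exprMn -hu -hv (_ : (t ^+ 2)%:A = t%:A ^+ 2 :> C); first by ring.
by rewrite exprZn expr1n.
Qed.

Lemma nonnegN1 : ~ nonneg (-1 : C).
Proof.
move=> /nonneg_dist [t]; rewrite opprK -[X in _ + X](scale1r 1) -scalerDl norm_alg.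
by have := ler_norm (t + 1); lra.
Qed.

Lemma nonneg_closed f : (forall e : R, 0 < e -> nonneg (f + e%:A)) -> nonneg f.
Proof.
(* The extra 1 keeps [2 t - f - d] nonnegative for all [d <= 1], so that [norm_le] applies to
   [t - (f + d)]. *)
move=> h; pose t := `|f| + 1; apply: (@dist_nonneg _ t).
apply/ler_addgt0Pr => e e0.
pose d : R := Num.min e 1.
have d0 : 0 < d by rewrite lt_min e0 ltr01.
have de : d <= e by rewrite ge_min lexx.
have d1 : d <= 1 by rewrite ge_min lexx orbT.
apply: (@le_trans _ _ (t + d)); last by rewrite lerD2l.
have -> : t%:A - f = (t%:A - (f + d%:A)) + d%:A by ring.
apply: le_trans (ler_normD _ _) _; rewrite norm_alg gtr0_norm // lerD2r.
apply: norm_le; first by rewrite addr_ge0.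
  by rewrite subKr; exact: h.
have -> : t%:A + (t%:A - (f + d%:A)) = t%:A + ((`|f|)%:A - f) + (1 - d)%:A.
  by rewrite /t !scalerDl scaleNr scale1r; ring.
apply: nonnegD; last by apply: nonneg_alg; lra.
by apply: nonnegD; [apply: nonneg_alg; rewrite addr_ge0|exact: le_norm].
Qed.

End PositiveCone.

(** * Characters *)

Section Characters.
Context (R : realType) (B : comCStarAlgType R).
Local Notation C := (selfadj B).
Local Notation character := {lrmorphism C -> R | *%R}.
Implicit Types (f g u v x : C).

(** Preorderings take the place of ideals: a maximal one is total and carries a character that is
    nonnegative on it. *)
Definition preordering (T : set C) : Prop :=
  [/\ @nonneg R B `<=` T, forall f g, T f -> T g -> T (f + g),
      forall f g, T f -> T g -> T (f * g) & ~ T (-1)].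

Lemma preordering_maximal (T0 : set C) : preordering T0 ->
  exists T, [/\ preordering T, T0 `<=` T &
    forall T', preordering T' -> T `<=` T' -> T' `<=` T].
Proof.
move=> h0; pose P (X : set C) := X = set0 \/ (preordering X /\ T0 `<=` X).
have [] := @Zorn_bigcup _ P.
  move=> F FP tot.
  have [[X [FX X0]]|hF] := pselect (exists X, F X /\ X !=set0); last first.
    left; apply/seteqP; split => // x [X FX Xx]; apply: hF.
    by exists X; split => //; exists x.
  have {X0} [pX TX] : preordering X /\ T0 `<=` X.
    by have [E|//] := FP _ FX; move: X0; rewrite E => -[].
  have pr Y y : F Y -> Y y -> preordering Y.
    by move=> FY Yy; have [E|[]//] := FP _ FY; move: Yy; rewrite E.
  right; split; last by apply: subset_trans TX _; exact: bigcup_sup.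
  case: (pX) => nX _ _ _.
  have join f g : (\bigcup_(Y in F) Y) f -> (\bigcup_(Y in F) Y) g ->
      exists Y, [/\ F Y, Y f & Y g].
    move=> [Y FY Yf] [Z FZ Zg]; have [h|h] := tot _ _ FY FZ.
      by exists Z; split => //; exact: h.
    by exists Y; split => //; exact: h.
  split.
  - by apply: subset_trans nX _; exact: bigcup_sup.
  - move=> f g /join h /h [Y [FY Yf Yg]]; exists Y => //.
    by have [_ hD _ _] := pr _ _ FY Yf; exact: hD.
  - move=> f g /join h /h [Y [FY Yf Yg]]; exists Y => //.
    by have [_ _ hM _] := pr _ _ FY Yf; exact: hM.
  - by move=> [Y FY YN]; have [_ _ _] := pr _ _ FY YN; apply.
move=> T [[T_0|[pT T0T]] mT].
  have hT : T `<` T0.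
    rewrite T_0; split => [//|h]; case: h0 => n0 _ _ _.
    exact: (h 0 (n0 _ (nonneg0 B))).
  by exfalso; apply: (mT _ hT); right; split.
exists T; split => // T' pT' TT'; apply: contrapT => h.
by apply: (mT T') => //; right; split => //; exact: subset_trans TT'.
Qed.

(** In a product of two elements [s + u t] the cross terms are multiples of [u], and the remaining
    [u^2] is a square, thus in [T]. *)
Lemma preordering_adjoin (T : set C) u : preordering T ->
  ~ (exists s t, [/\ T s, T t & -1 = s + u * t]) ->
  preordering [set f | exists s t, [/\ T s, T t & f = s + u * t]].
Proof.
move=> [nT dT mT _] hu.
have T0 : T 0 by apply: nT; exact: nonneg0.
split => //.
- by move=> f /nT Tf; exists f, 0; rewrite mulr0 addr0.
- move=> _ _ [s [t [Ts Tt ->]]] [s' [t' [Ts' Tt' ->]]].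
  exists (s + s'), (t + t'); split; [exact: dT|exact: dT|by ring].
- move=> _ _ [s [t [Ts Tt ->]]] [s' [t' [Ts' Tt' ->]]].
  exists (s * s' + u ^+ 2 * (t * t')), (s * t' + t * s'); split.
  + by apply: (dT); [exact: mT|apply: (mT); [apply: nT; exact: sqr_nonneg|exact: mT]].
  + by apply: (dT); exact: mT.
  + by ring.
Qed.

(** If neither [f] nor [- f] could be adjoined, then [f t = -1 - s] and [- f t' = -1 - s'] with
    coefficients in [T]; multiplying these equations exhibits [-1] in [T]. *)
Lemma maximal_total (T : set C) : preordering T ->
  (forall T', preordering T' -> T `<=` T' -> T' `<=` T) ->
  forall f, T f \/ T (- f).
Proof.
move=> pT mT f; case: (pT) => nT dT muT NT.
have T0 : T 0 by apply: nT; exact: nonneg0.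
have T1 : T 1 by apply: nT; exact: nonneg1.
have adj u : ~ (exists s t, [/\ T s, T t & -1 = s + u * t]) -> T u.
  move=> /(preordering_adjoin pT) p; apply: (mT _ p).
    by move=> x Tx; exists x, 0; rewrite mulr0 addr0.
  by exists 0, 1; rewrite mulr1 add0r.
have [h|/adj] := pselect (exists s t, [/\ T s, T t & -1 = s + f * t]); last by left.
have [h'|/adj] := pselect (exists s t, [/\ T s, T t & -1 = s + - f * t]); last by right.
case: h => s [t [Ts Tt h]]; case: h' => s' [t' [Ts' Tt' h']].
exfalso; apply: NT.
have -> : -1 = s + s' + s * s' + f ^+ 2 * (t * t').
  have E1 : f * t = -1 - s by rewrite h; ring.
  have E2 : - f * t' = -1 - s' by rewrite h'; ring.
  have -> : f ^+ 2 * (t * t') = - ((f * t) * (- f * t')) by ring.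
  by rewrite E1 E2; ring.
apply: (dT); first by apply: (dT); [exact: dT|exact: muT].
by apply: (muT); [apply: nT; exact: sqr_nonneg|exact: muT].
Qed.

Lemma mk_character (chi : C -> R) : scalar chi -> chi 1 = 1 ->
  {morph chi : x y / x * y} -> exists c : character, c =1 chi.
Proof.
move=> hl h1 hm.
pose c : character := HB.pack chi (GRing.isLinear.Build R C R *%R chi hl)
  (GRing.isMonoidMorphism.Build C R chi (conj h1 hm)).
by exists c.
Qed.

(* Modulo the ideal [I] of elements infinitesimal for [T], every element is
   congruent to a unique real number. *)
Lemma maximal_character (T : set C) : preordering T ->
  (forall f, T f \/ T (- f)) ->
  exists chi : character, forall f, T f -> 0 <= chi f.
Proof.
move=> [nT dT mT NT] tT.
have TA t : 0 <= t -> T t%:A by move=> t0; apply: nT; exact: nonneg_alg.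
have TZ t f : 0 <= t -> T f -> T (t *: f).
  by move=> t0 Tf; rewrite -mulr_algl; apply: mT => //; exact: TA.
have AT t : T t%:A -> 0 <= t.
  move=> Tt; rewrite leNgt; apply/negP => t0; apply: NT.
  have := TZ (- t)^-1 _ _ Tt; rewrite invr_ge0 oppr_ge0 ltW // => /(_ isT).
  by rewrite scalerA invrN mulNr mulVf ?scaleN1r // lt_eqF.
have Tb f t : T (f - t%:A) -> t <= `|f|.
  move=> h; rewrite -subr_ge0; apply: AT.
  rewrite (_ : _%:A = ((`|f|)%:A - f) + (f - t%:A)); last by rewrite scalerBl; ring.
  by apply: dT => //; apply: nT; exact: le_norm.
pose I f := forall e : R, 0 < e -> T (e%:A + f) /\ T (e%:A - f).
have ID f g : I f -> I g -> I (f + g).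
  move=> If Ig e e0; have e2 : 0 < e / 2 by rewrite divr_gt0.
  have [h1 h2] := If _ e2; have [h3 h4] := Ig _ e2.
  have E : e%:A = (e / 2)%:A + (e / 2)%:A :> C by rewrite -scalerDl -splitr.
  rewrite E opprD; split; rewrite addrACA; exact: dT.
have IM f g : I f -> I (f * g).
  move=> If e e0; pose M := `|g| + 1; have M0 : 0 < M by rewrite ltr_wpDl.
  have eM : 0 < e / M by rewrite divr_gt0.
  have [h1 h2] := If _ eM.
  have gM : `|g| <= M by rewrite lerDl.
  have h3 : T (M%:A - g) by apply: nT; exact: le_norm.
  have h4 : T (M%:A + g).
    by rewrite -[g]opprK; apply: nT; apply: le_norm; rewrite normrN.
  have E : e%:A = (e / M)%:A * M%:A :> C.
    by rewrite -scalerAl mul1r scalerA divfK // gt_eqF.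
  split.
    (* Polarization: [2 (e + f g) = (e/M + f) (M + g) + (e/M - f) (M - g)], with all four factors in
       [T]. *)
    rewrite (_ : _ + _ = 2^-1 *: (((e / M)%:A + f) * (M%:A + g)
      + ((e / M)%:A - f) * (M%:A - g))).
      by apply: TZ; rewrite ?invr_ge0 //; apply: (dT); exact: mT.
    rewrite (_ : _ * _ + _ = (e%:A + f * g) *+ 2); last by rewrite E; ring.
    by rewrite -scaler_nat scalerA mulVf ?scale1r // pnatr_eq0.
  rewrite (_ : _ - _ = 2^-1 *: (((e / M)%:A + f) * (M%:A - g)
    + ((e / M)%:A - f) * (M%:A + g))).
    by apply: TZ; rewrite ?invr_ge0 //; apply: (dT); exact: mT.
  rewrite (_ : _ * _ + _ = (e%:A - f * g) *+ 2); last by rewrite E; ring.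
  by rewrite -scaler_nat scalerA mulVf ?scale1r // pnatr_eq0.
have IA t : I t%:A -> t = 0.
  move=> h; apply: le_anti; apply/andP; split; apply/ler_addgt0Pr => e /h [].
    by rewrite -scalerBl => _ /AT; lra.
  by rewrite -scalerDl => /AT; lra.
have Iuniq f s t : I (f - s%:A) -> I (f - t%:A) -> s = t.
  move=> hs ht; apply/eqP; rewrite -subr_eq0; apply/eqP/IA.
  rewrite (_ : _%:A = (f - t%:A) + (f - s%:A) * -1); last by rewrite scalerBl; ring.
  by apply: ID => //; exact: IM.
(* The residue of [f] is the supremum of the [t] with [f - t] in [T]; totality gives [t - f] in [T]
   for every [t] beyond it. *)
have Iex f : exists t, I (f - t%:A).
  pose S := [set t | T (f - t%:A)].
  have hS : has_sup S.
    split; last by exists `|f| => t; exact: Tb.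
    exists (- `|f|); rewrite /S /= scaleNr opprK addrC -[X in _ + X]opprK.
    by apply: nT; apply: le_norm; rewrite normrN.
  exists (sup S) => e e0; split.
    have [t St ht] := sup_adherent e0 hS.
    rewrite (_ : e%:A + _ = (f - t%:A) + (t - (sup S - e))%:A); last first.
      by rewrite !scalerBl; ring.
    by apply: dT => //; apply: TA; rewrite subr_ge0 ltW.
  rewrite (_ : _ - _ = - (f - (sup S + e)%:A)); last by rewrite scalerDl; ring.
  have [h|//] := tT (f - (sup S + e)%:A).
  have : sup S + e <= sup S by apply: ub_le_sup => //; case: hS.
  by rewrite gerDl leNgt e0.
have [chi hchi] := choice Iex.
(* Since residues are unique, it suffices that the proposed value differs from the element by a
   member of the ideal [I]. *)
have hl : scalar chi.
  move=> a f g; apply: (Iuniq (a *: f + g)); first exact: hchi.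
  rewrite (_ : _ - _ = (f - (chi f)%:A) * a%:A + (g - (chi g)%:A)).
    by apply: ID => //; exact: IM.
  rewrite scalerDl -(scalerA a) -[a *: f]mulr_algl -[a *: _%:A]mulr_algl.
  by ring.
have h1 : chi 1 = 1.
  apply: (Iuniq 1); first exact: hchi.
  by rewrite scale1r subrr => e e0; rewrite addr0 subr0; split; exact: TA (ltW _).
have hm : {morph chi : x y / x * y}.
  move=> f g; apply: (Iuniq (f * g)); first exact: hchi.
  rewrite (_ : _ - _ = (f - (chi f)%:A) * g + (g - (chi g)%:A) * (chi f)%:A).
    by apply: ID; exact: IM.
  by rewrite -(scalerA (chi f)) -[chi f *: _%:A]mulr_algl; ring.
have [c hc] := mk_character hl h1 hm.
exists c => f Tf; rewrite hc; apply/ler_addgt0Pr => e e0; rewrite addrC.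
have [_ h] := hchi f e e0; apply: AT.
rewrite scalerDl (_ : _ + _ = (e%:A - (f - (chi f)%:A)) + f); last by ring.
exact: dT.
Qed.

(* If [-1 = s - u t] with [s, t >= 0], then [w := u t = 1 + s >= 1], so
   [u (1 - (1 - w/|w|)^k)^2] is nonnegative and tends to [u]. *)
Lemma exists_character_le0 u : ~ nonneg u -> exists chi : character, chi u <= 0.
Proof.
move=> nu.
have pP : preordering (@nonneg R B).
  split => //; [exact: nonnegD|exact: nonnegM|exact: nonnegN1].
have [] : exists T, [/\ preordering T, T (- u) &
    forall T', preordering T' -> T `<=` T' -> T' `<=` T]; last first.
  move=> T [pT Tu mT]; have [chi hchi] := maximal_character pT (maximal_total pT mT).
  by exists chi; have := hchi _ Tu; rewrite raddfN oppr_ge0.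
have n0 := nonneg0 B; have n1 := nonneg1 B.
have [|T [pT h mT]] := preordering_maximal
  (T0 := [set f | exists s t, [/\ nonneg s, nonneg t & f = s + (- u) * t]]); last first.
  by exists T; split => //; apply: h; exists 0, 1; rewrite mulr1 add0r.
apply: preordering_adjoin => // -[s [t [ns nt h]]]; apply: nu.
pose w := u * t.
have ws : w = 1 + s by rewrite /w -[u * t]opprK -mulNr -[X in X + s]opprK h; ring.
have nw : nonneg w by rewrite ws; exact: nonnegD.
pose M := `|w|.
have M1 : 1 <= M.
  rewrite leNgt; apply/negP => M1.
  have : nonneg ((M%:A - w) + s) by apply: nonnegD => //; exact: le_norm.
  rewrite (_ : _ + _ = (M - 1)%:A); last by rewrite ws scalerBl scale1r; ring.
  move=> /(@nonnegZ _ _ (1 - M)^-1); rewrite invr_ge0 subr_ge0 ltW // => /(_ isT).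
  rewrite scalerA -(opprB 1 M) mulrN mulVf ?gt_eqF ?subr_gt0 // scaleN1r.
  exact: nonnegN1.
have M0 : 0 < M by apply: lt_le_trans M1.
pose q := 1 - M^-1; pose x := 1 - M^-1 *: w.
have q0 : 0 <= q by rewrite subr_ge0 invf_le1.
have q1 : q < 1 by rewrite gtrBl invr_gt0.
have xq : `|x| <= q.
  apply: norm_le => //.
    rewrite (_ : _ - _ = M^-1 *: s); first by apply: nonnegZ; rewrite ?invr_ge0 ?ltW.
    rewrite /x /q ws scalerDr scalerBl scale1r; move: (M^-1 *: s) (M^-1%:A) => X Y.
    by ring.
  rewrite (_ : _ + _ = q%:A + M^-1 *: (M%:A - w)).
    apply: nonnegD; first exact: nonneg_alg.
    by apply: nonnegZ; [rewrite invr_ge0 ltW|exact: le_norm].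
  by rewrite scalerBr scalerA mulVf ?scale1r // gt_eqF.
(* [1 - x^k] is a multiple of [w = u t], so its square supplies a second factor [u]: the product is
   [u^2 t w] times a square. *)
have xk k : nonneg (u * (1 - x ^+ k) ^+ 2).
  pose S := \sum_(i < k) x ^+ i.
  rewrite (_ : _ * _ = u ^+ 2 * (t * w * (M^-1 *: S) ^+ 2)).
    apply: nonnegM; first exact: sqr_nonneg.
    by apply: nonnegM; [exact: nonnegM|exact: sqr_nonneg].
  have -> : 1 - x ^+ k = w * (M^-1 *: S).
    rewrite -opprB subrX1 -/S /x -(opprB 1) subKr mulNr opprK.
    by rewrite -scalerAl -scalerAr.
  by rewrite /w; move: (M^-1 *: S) => X; ring.
apply: nonneg_closed => e e0.
(* The constant 3 bounds [|x^k - 2|] in the remainder [u x^k (x^k - 2)]. *)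
have [k hk] : exists k, 3 * `|u| * q ^+ k < e.
  have cq : q ^+ k @[k --> \oo] --> 0 by apply: cvg_expr; rewrite ger0_norm.
  have U0 : 0 < e / (3 * `|u| + 1) by rewrite divr_gt0 // ltr_wpDl // mulr_ge0.
  have /cvgr_lt /(_ _ U0) [k _ /(_ k (leqnn k))] /= := cq.
  rewrite ltr_pdivlMr ?ltr_wpDl ?mulr_ge0 // => h1.
  exists k; apply: le_lt_trans h1; rewrite mulrC ler_wpM2l ?exprn_ge0 //.
  by rewrite lerDl.
have xqk : `|x ^+ k| <= q ^+ k.
  elim: k {hk} => [|k IH]; first by rewrite !expr0 selfadj_norm1.
  by rewrite !exprS; apply: le_trans (selfadj_normM _ _) _; apply: ler_pM.
rewrite (_ : u + e%:A = u * (1 - x ^+ k) ^+ 2 + (e%:A - u * x ^+ k * (x ^+ k - 2))).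
  apply: nonnegD => //; apply: le_norm; apply: le_trans (ltW hk).
  have h2 : `|x ^+ k - 2| <= 3.
    apply: le_trans (ler_normB _ _) _.
    have : `|1 + 1 : C| <= 1 + 1 by rewrite -[X in _ <= X + X](selfadj_norm1 B) ler_normD.
    have : q ^+ k <= 1 by apply: exprn_ile1 => //; exact: ltW.
    lra.
  rewrite -mulrA mulrC; apply: le_trans (selfadj_normM _ _) _; rewrite mulrC -mulrA mulrCA.
  rewrite ler_wpM2l //; apply: le_trans (selfadj_normM _ _) _.
  by rewrite mulrC; apply: ler_pM.
by ring.
Qed.

End Characters.

(** * Order, norm, exponential and logarithm through characters *)

Section Gelfand.
Context (R : realType) (B : comCStarAlgType R).
Local Notation C := (selfadj B).
Local Notation character := {lrmorphism C -> R | *%R}.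
Implicit Types (f g u v x : C) (chi : character).

Lemma char_alg chi (t : R) : chi t%:A = t.
Proof. by rewrite scalarZ rmorph1 mulr1. Qed.

Lemma char_ge0 chi f : nonneg f -> 0 <= chi f.
Proof. by move=> /nonneg_sqrt [s [-> _]]; rewrite rmorphXn sqr_ge0. Qed.

(** If [f + e] were not nonnegative, some character would have [chi f <= - e]; the cone is closed,
    so [e] may tend to 0. *)
Lemma nonnegP f : nonneg f <-> forall chi, 0 <= chi f.
Proof.
split=> [h chi|h]; first exact: char_ge0.
apply: nonneg_closed => e e0; apply: contrapT => /exists_character_le0 [chi].
by have := h chi; rewrite raddfD /= char_alg; lra.
Qed.

Lemma normP f (t : R) : 0 <= t -> `|f| <= t <-> forall chi, `|chi f| <= t.
Proof.
move=> t0; split=> [h chi|h].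
  rewrite ler_norml; apply/andP; split.
    rewrite -normrN in h; have /(char_ge0 chi) := le_norm h.
    by rewrite opprK raddfD /= char_alg; lra.
  by have /(char_ge0 chi) := le_norm h; rewrite raddfB /= char_alg; lra.
apply: norm_le => //; apply/nonnegP => chi; have := h chi; rewrite ler_norml.
  by rewrite raddfB /= char_alg => /andP[]; lra.
by rewrite raddfD /= char_alg => /andP[]; lra.
Qed.

Lemma char_norm chi f : `|chi f| <= `|f|.
Proof. by have /normP : `|f| <= `|f| by []; apply. Qed.

Lemma char_inj f g : (forall chi, chi f = chi g) -> f = g.
Proof.
move=> h; apply/eqP; rewrite -subr_eq0 -normr_le0; apply/normP => // chi.
by rewrite raddfB /= h subrr normr0.
Qed.

Lemma exists_character : exists chi : character, True.
Proof.
have [chi _] := exists_character_le0 (@nonnegN1 R B).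
by exists chi.
Qed.

Lemma char_lt_norm f (t : R) : nonneg f -> 0 <= t -> t < `|f| ->
  exists chi, t < chi f.
Proof.
move=> nf t0 tf; apply: contrapT => h; move: tf; rewrite ltNge => /negP; apply.
apply/normP => // chi; rewrite ger0_norm ?char_ge0 // leNgt; apply/negP => ht.
by apply: h; exists chi.
Qed.

Lemma char_eps_lim chi (w : nat -> C) l (c : R) :
  (forall e : R, 0 < e -> exists N : nat, forall n : nat,
       (N <= n)%N -> `|w n - l| < e) ->
  (forall e : R, 0 < e -> exists N : nat, forall n : nat,
       (N <= n)%N -> `|chi (w n) - c| < e) -> chi l = c.
Proof.
move=> hl hc; apply/eqP; rewrite -subr_eq0 -normr_le0; apply/ler_addgt0Pr => e e0.
have e2 : 0 < e / 2 by rewrite divr_gt0.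
have [N hN] := hl _ e2; have [M hM] := hc _ e2.
have := hN _ (leq_maxl N M); have := hM _ (leq_maxr N M).
move: (maxn _ _) => n h1 h2; rewrite add0r.
have := le_lt_trans (char_norm chi _) h2; rewrite raddfB /= => h3.
rewrite (_ : _ - _ = (chi (w n) - c) - (chi (w n) - chi l)); last by ring.
by apply: le_trans (ler_normB _ _) _; lra.
Qed.

Lemma cvg_eps (w : nat -> R) c : w @ \oo --> c ->
  forall e : R, 0 < e -> exists N : nat, forall n : nat,
    (N <= n)%N -> `|w n - c| < e.
Proof.
move=> /cvgrPdist_lt h e /h [N _ hN]; exists N => n Nn.
by rewrite distrC; exact: hN.
Qed.

(** The series is Cauchy by comparison with the real exponential series at [|f|], and characters,
    being contractive, carry its limit to the real one. *)
Lemma char_expC chi f : chi (expC f) = expR (chi f).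
Proof.
pose w : nat -> C := series (fun k => (k`!%:R : R)^-1 *: f ^+ k).
have wc n : chi (w n) = series (exp_coeff (chi f)) n.
  rewrite /w /series /= raddf_sum; apply: eq_bigr => k _ /=.
  by rewrite scalarZ rmorphXn /exp_coeff /= mulrC.
have cauchy (e : R) : 0 < e -> exists N : nat, forall m n : nat,
     (N <= m)%N -> (N <= n)%N -> `|w m - w n| < e.
  move=> e0; have e2 : 0 < e / 2 by rewrite divr_gt0.
  have [N hN] := cvg_eps (is_cvg_series_exp_coeff `|f|) e2.
  exists N.
  suff H m n : (N <= n)%N -> (n <= m)%N -> `|w m - w n| < e.
    move=> m n Nm Nn; have [|/ltnW] := leqP n m; first exact: H.
    by rewrite distrC; exact: H.
  move=> Nn nm; apply: (@le_lt_trans _ _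
    (series (exp_coeff `|f|) m - series (exp_coeff `|f|) n)).
    rewrite /w !sub_series_geq //; apply: le_trans (ler_norm_sum _ _ _) _.
    apply: ler_sum => k _; rewrite normrZ gtr0_norm ?invr_gt0 ?ltr0n ?fact_gt0 //.
    rewrite /exp_coeff /= mulrC ler_pM2r ?invr_gt0 ?ltr0n ?fact_gt0 //.
    elim: k => [|k IH]; first by rewrite !expr0 selfadj_norm1.
    by rewrite !exprS; apply: le_trans (selfadj_normM _ _) _; apply: ler_pM.
  have := hN _ Nn; have := hN _ (leq_trans Nn nm).
  by rewrite !ltr_norml => /andP[? ?] /andP[? ?]; lra.
have [l hl] := selfadj_cauchy_cvg cauchy.
have -> : expC f = l.
  apply: cvg_lim; first exact: norm_hausdorff.
  apply/cvgrPdist_lt => e /hl [N hN]; exists N => // n /= Nn.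
  by rewrite distrC; exact: hN.
apply: (char_eps_lim hl) => e e0.
have [N hN] := cvg_eps (is_cvg_series_exp_coeff (chi f)) e0.
by exists N => n Nn; rewrite wc; exact: hN.
Qed.

Lemma expCD f g : expC (f + g) = expC f * expC g.
Proof.
by apply: char_inj => chi; rewrite rmorphM /= !char_expC raddfD /= expRD.
Qed.

Lemma expC0 : expC (0 : C) = 1.
Proof. by apply: char_inj => chi; rewrite char_expC raddf0 rmorph1 expR0. Qed.

Lemma expC_nonneg f : nonneg (expC f).
Proof. by apply/nonnegP => chi; rewrite char_expC expR_ge0. Qed.

Lemma lrmorph_expC (delta : {lrmorphism C -> C}) f :
  delta (expC f) = expC (delta f).
Proof.
apply: char_inj => chi; rewrite char_expC.
exact: (char_expC (chi \o delta : character) f).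
Qed.

(** A rate for [k (e^(x/k) - 1) -> x] that depends on [x] only through the bound [X], hence is
    uniform over characters in [exists_ln]. *)
Lemma expR_root_approx (X x k : R) : `|x| <= X -> 1 <= k ->
  `|k * (expR (x / k) - 1) - x| <= X ^+ 2 * expR X / k.
Proof.
move=> xX k1; have k0 : 0 < k by apply: lt_le_trans k1.
have [y yE] : exists y, y = x / k by exists (x / k).
rewrite -yE; have xy : x = k * y by rewrite yE mulrC divfK // gt_eqF.
have X0 : 0 <= X by apply: le_trans xX.
have yX : `|y| <= X.
  apply: le_trans xX; rewrite xy normrM (gtr0_norm k0).
  by rewrite ler_peMl.
have h1 := expR_ge1Dx y; have h2 := expR_ge1Dx (- y).
have h3 : expR y * expR (- y) = 1 by rewrite -expRD subrr expR0.
have h4 : 0 < expR y by exact: expR_gt0.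
have h5 : expR y <= expR X by rewrite ler_expR (le_trans (ler_norm _)).
have h6 : expR y - 1 <= y * expR y by nra.
rewrite ger0_norm; last by rewrite xy; nra.
have -> : X ^+ 2 * expR X / k = k * ((X / k) ^+ 2 * expR X).
  by field; rewrite gt_eqF.
rewrite xy -mulrBr ler_pM2l //.
have y2 : y ^+ 2 <= (X / k) ^+ 2.
  rewrite -(real_normK (num_real y)) yE normrM normfV (gtr0_norm k0).
  by rewrite lerXn2r ?nnegrE ?divr_ge0 // ?(ltW k0) // ler_pM2r ?invr_gt0.
have h7 : expR y - 1 - y <= y * (expR y - 1) by lra.
have h8 : y * (expR y - 1) <= y ^+ 2 * expR X.
  have eX : 1 <= expR X by have := expR_ge1Dx X; lra.
  have [y0|y0] := leP 0 y.
    apply: (@le_trans _ _ (y * (y * expR y))); first by rewrite ler_wpM2l.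
    by rewrite mulrA -expr2 ler_wpM2l // sqr_ge0.
  apply: (@le_trans _ _ (y ^+ 2)); first by nra.
  by rewrite ler_peMr // sqr_ge0.
apply: le_trans h7 _; apply: le_trans h8 _.
by rewrite ler_pM2r ?expR_gt0.
Qed.

(* The logarithm is the limit of [2^j (f^(1/2^j) - 1)]. *)
Lemma exists_ln f (e : R) : 0 < e -> (forall chi, e <= chi f) ->
  exists L : C, forall chi, chi L = ln (chi f).
Proof.
move=> e0 fe.
have [root hroot] : exists root : C -> C, forall g, nonneg g ->
    g = root g ^+ 2 /\ nonneg (root g).
  have h g : exists s, nonneg g -> g = s ^+ 2 /\ nonneg s.
    have [/nonneg_sqrt [s hs]|ng] := pselect (nonneg g); first by exists s.
    by exists 0.
  by have [root hroot] := choice h; exists root.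
pose s j := iter j root f.
have s0 j : nonneg (s j).
  elim: j => [|j /= IH]; last by have [] := hroot _ IH.
  by apply/nonnegP => chi; apply: le_trans (fe chi); exact: ltW.
have cs chi j : chi (s j) = expR (ln (chi f) / 2 ^+ j).
  elim: j => [|j IH].
    by rewrite expr0 divr1 lnK // posrE; apply: lt_le_trans (fe chi).
  have [E n1] := hroot _ (s0 j).
  have c0 := char_ge0 chi (s0 j.+1).
  apply/eqP; rewrite -(@eqrXn2 _ 2) ?expR_ge0 // -rmorphXn /= -E IH.
  rewrite -expRM_natl; apply/eqP; congr expR; rewrite exprS.
  by field; rewrite expf_neq0.
(* A bound for [|ln (chi f)|] common to all characters, from [e <= chi f <= |f|]. *)
pose X := `|ln e| + `|ln `|f| |.
have lX chi : `|ln (chi f)| <= X.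
  have h1 := lt_le_trans e0 (fe chi).
  have h2 : chi f <= `|f| := le_trans (ler_norm _) (char_norm chi f).
  have h3 := lt_le_trans h1 h2.
  have h4 : ln e <= ln (chi f) by rewrite ler_ln.
  have h5 : ln (chi f) <= ln `|f| by rewrite ler_ln.
  rewrite ler_norml /X; apply/andP; split.
    by have := ler_norm (- ln e); rewrite normrN; have := normr_ge0 (ln `|f|); lra.
  by have := ler_norm (ln `|f|); have := normr_ge0 (ln e); lra.
pose L j := (2 ^+ j) *: (s j - 1).
pose K := X ^+ 2 * expR X.
have K0 : 0 <= K by rewrite mulr_ge0 ?sqr_ge0 ?expR_ge0.
have hL chi j : `|chi (L j) - ln (chi f)| <= K / 2 ^+ j.
  rewrite /L scalarZ raddfB /= rmorph1 cs; apply: expR_root_approx => //.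
  by rewrite exprn_ege1 // ler1n.
have small (d : R) : 0 < d -> exists N, forall j, (N <= j)%N -> K / 2 ^+ j < d.
  move=> d0; have Kd : 0 < d / (K + 1) by rewrite divr_gt0 // ltr_wpDl.
  have cq : (2^-1 : R) ^+ k @[k --> \oo] --> 0.
    by apply: cvg_expr; rewrite gtr0_norm ?invr_gt0 // invf_lt1 // ltr1n.
  have [N hN] := cvg_eps cq Kd; exists N => j /hN.
  rewrite subr0 ger0_norm ?exprn_ge0 ?invr_ge0 // exprVn.
  rewrite ltr_pdivlMr ?ltr_wpDl // => h; apply: le_lt_trans h.
  by rewrite mulrC ler_wpM2l ?invr_ge0 ?exprn_ge0 // lerDl.
have [l hl] : exists l : C, forall d : R, 0 < d -> exists N : nat, forall n : nat,
       (N <= n)%N -> `|L n - l| < d.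
  apply: selfadj_cauchy_cvg => d d0; have [N hN] := small (d / 4) (divr_gt0 d0 (ltr0Sn _ 3)).
  exists N => m n /hN hm /hN hn; apply: (@le_lt_trans _ _ (d / 2)); last by lra.
  apply/normP => [|chi]; first by lra.
  have := hL chi m; have := hL chi n; rewrite raddfB /= !ler_norml.
  by move=> /andP[? ?] /andP[? ?]; apply/andP; split; lra.
exists l => chi; apply: (char_eps_lim hl) => d /small [N hN].
by exists N => n /hN; apply: le_lt_trans (hL chi n).
Qed.

End Gelfand.

(** * The upper bound *)

Section Bernstein.
Context (K : comNzRingType).
Implicit Types (t z : K).

Definition bernstein t N i : K := ((1 - t) ^+ (N - i) * t ^+ i) *+ 'C(N, i).

(** Used with [z = e^h], where the powers [z^i] are, up to a constant factor, the exponentials of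
    equally spaced nodes. *)
Lemma bernstein_gen t z N :
  \sum_(i < N.+1) z ^+ i * bernstein t N i = (1 - t + z * t) ^+ N.
Proof.
rewrite exprDn; apply: eq_bigr => i _.
by rewrite /bernstein mulrnAr exprMn mulrCA.
Qed.

Lemma bernstein_sum t N : \sum_(i < N.+1) bernstein t N i = 1.
Proof.
rewrite -[RHS](expr1n _ N) -[X in X ^+ _](subrK t) -[X in _ + X]mul1r.
by rewrite -bernstein_gen; apply: eq_bigr => i _; rewrite expr1n mul1r.
Qed.

(** [i C(N, i) = N C(N-1, i-1)] reduces the mean to the partition identity one degree lower. *)
Lemma bernstein_mean t N : \sum_(i < N.+1) bernstein t N i *+ i = t *+ N.
Proof.
case: N => [|N]; first by rewrite big_ord1 !mulr0n.
have -> : t *+ N.+1 = \sum_(i < N.+1) (t * bernstein t N i) *+ N.+1.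
  by rewrite sumrMnl -mulr_sumr bernstein_sum mulr1.
rewrite big_ord_recl /= mulr0n add0r; apply: eq_bigr => i _.
rewrite /bernstein /bump /= add1n subSS -mulrnA mulnC -mul_bin_diag mulnC mulrnA.
by rewrite exprS mulrnAr; congr (_ *+ _ *+ _); ring.
Qed.

End Bernstein.

(** * Real inequalities for the upper bound *)

Section Reals.
Context (R : realType).

Lemma ln_le_subr1 (y : R) : 0 < y -> ln y <= y - 1.
Proof. by move=> y0; have := expR_ge1Dx (ln y); rewrite lnK ?posrE //; lra. Qed.

(** The logarithm lies below its tangent at [a]; evaluated at [y / x] and multiplied by [x], this is
    linear in [x] and [y] and also covers both zero conventions. *)
Lemma summand_tangent (x y a : R) : 0 <= x -> 0 <= y -> 0 < a ->
  ((if x == 0%R then 0 else x%:E * lne (y / x)%:E) <=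
   (x * ln a + y / a - x)%:E)%E.
Proof.
move=> x0 y0 a0; case: eqVneq => [->|xn0].
  by rewrite lee_fin mul0r add0r subr0 divr_ge0 // ltW.
have xp : 0 < x by rewrite lt_def xn0.
have [->|yn0] := eqVneq y 0.
  by rewrite mul0r /lne lexx gt0_muleNy ?lte_fin // leNye.
have yp : 0 < y by rewrite lt_def yn0.
rewrite lne_EFin ?divr_gt0 // -EFinM lee_fin.
have h : 0 < y / (x * a) by rewrite divr_gt0 // mulr_gt0.
have -> : y / x = a * (y / (x * a)) by field; rewrite !gt_eqF.
rewrite lnM ?posrE // mulrDr -addrA lerD2l.
have -> : y / a - x = x * (y / (x * a) - 1) by field; rewrite !gt_eqF.
by rewrite ler_pM2l // ln_le_subr1.
Qed.

(** One factor of the generating function at [z = e^(b/N)]; its [N]-th power is at most [e^(b s)] up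
    to a factor tending to 1. *)
Lemma bernstein_exp_bound (s b N : R) : 0 <= s <= 1 -> 0 <= b -> 1 <= N ->
  1 - s + expR (b / N) * s <= expR ((b * s + b ^+ 2 * expR b / N) / N).
Proof.
move=> /andP[s0 s1] b0 N1; have N0 : 0 < N by apply: lt_le_trans N1.
have [h hE] : exists h, h = b / N by exists (b / N).
have bh : b = h * N by rewrite hE divfK // gt_eqF.
have h0 : 0 <= h by rewrite hE divr_ge0 // ltW.
have hb : h <= b by rewrite bh ler_peMr.
rewrite -hE; apply: le_trans (expR_ge1Dx _).
have -> : (b * s + b ^+ 2 * expR b / N) / N = h * s + h ^+ 2 * expR b.
  by rewrite {1 2}bh; field; rewrite gt_eqF.
have h3 : expR h * expR (- h) = 1 by rewrite -expRD subrr expR0.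
have h2 := expR_ge1Dx (- h); have h4 : 0 < expR h by exact: expR_gt0.
have h5 : expR h <= expR b by rewrite ler_expR.
have h6 : expR h - 1 <= h * expR h by nra.
have h7 : h * (expR h - 1) <= h * (h * expR b).
  by rewrite ler_wpM2l // (le_trans h6) // ler_wpM2l.
have h8 : expR h - 1 - h <= h * (expR h - 1) by lra.
have h9 : 0 <= h * (h * expR b) by rewrite !mulr_ge0 // ltW ?expR_gt0.
nra.
Qed.

End Reals.

(** * Positive functionals and operators *)

Section Positive.
Context (R : realType) (B : comCStarAlgType R).
Local Notation C := (selfadj B).
Local Notation character := {lrmorphism C -> R | *%R}.
Implicit Types (f g : C) (chi : character).

Lemma functional_le (k : {scalar C}) f g :
  (forall h, nonneg h -> 0 <= k h) -> (forall chi, chi f <= chi g) -> k f <= k g.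
Proof.
move=> kp fg; rewrite -subr_ge0 -raddfB; apply/kp/nonnegP => chi.
rewrite raddfB /= subr_ge0; exact: fg.
Qed.

Lemma functional_norm (k : {scalar C}) f :
  (forall h, nonneg h -> 0 <= k h) -> `|k f| <= `|f| * k 1.
Proof.
move=> kp; have E : `|f| * k 1 = k (`|f|%:A) by rewrite scalarZ.
rewrite E ler_norml; apply/andP; split.
  rewrite -raddfN /=; apply: functional_le => // chi; rewrite raddfN /= char_alg.
  by have := char_norm chi f; rewrite ler_norml => /andP[].
apply: functional_le => // chi; rewrite char_alg.
by have := char_norm chi f; rewrite ler_norml => /andP[].
Qed.

Lemma state_norm (mu : {scalar C}) f : states mu -> `|mu f| <= `|f|.
Proof. by case=> mp m1; rewrite -[leRHS]mulr1 -m1; exact: functional_norm. Qed.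

Lemma character_state chi : states (chi : {scalar C}).
Proof. by split => [f|]; [exact: char_ge0|rewrite rmorph1]. Qed.

Lemma positive_norm (T : {linear C -> C}) f :
  (forall h, nonneg h -> nonneg (T h)) -> `|T f| <= `|f| * `|T 1|.
Proof.
move=> Tp; apply/normP => [|chi]; first by rewrite mulr_ge0.
pose k : {scalar C} := chi \o T.
have kp h : nonneg h -> 0 <= k h by move=> /Tp /(char_ge0 chi).
apply: le_trans (functional_norm f kp) _; rewrite ler_wpM2l //.
exact: le_trans (ler_norm _) (char_norm chi _).
Qed.

Lemma iter_nonneg (T : C -> C) n f :
  (forall h, nonneg h -> nonneg (T h)) -> nonneg f -> nonneg (iter n T f).
Proof. by move=> Tp nf; elim: n => //= n; exact: Tp. Qed.

(** Iterates bundled as linear maps, so that the lemmas on linear and positive operators apply to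
    them. *)
Fixpoint powL (T : {linear C -> C}) n : {linear C -> C} :=
  if n is m.+1 then T \o powL T m else idfun.

Lemma powLE T n f : powL T n f = iter n T f.
Proof. by elim: n => //= n ->. Qed.

Fixpoint powLR (T : {lrmorphism C -> C}) n : {lrmorphism C -> C} :=
  if n is m.+1 then T \o powLR T m else idfun.

Lemma powLRE T n f : powLR T n f = iter n T f.
Proof. by elim: n => //= n ->. Qed.

End Positive.

(** * From families to sets of distinct elements *)

Section DistinctPartition.
Context (R : realType) (B : comCStarAlgType R).
Local Notation C := (selfadj B).

(* Repeated terms of a finite family are made distinct by splitting each
   [g] into proportional parts, to which homogeneous sums are insensitive. *)
Lemma seq_to_fset (s : seq C) : (forall g, g \in s -> nonneg g) ->
  exists D : {fset C}, (forall g, g \in D -> nonneg g) /\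
    forall (V : nmodType) (h : C -> V), h 0 = 0 ->
      (forall g (c : R), nonneg g -> 0 < c < 1 -> h g = h (c *: g) + h ((1 - c) *: g)) ->
      \sum_(g <- D) h g = \sum_(g <- s) h g.
Proof.
elim: s => [|g s IH] hs.
  by exists fset0; split => [g|V h _ _]; rewrite ?inE // big_seq_fset0 big_nil.
have ng : nonneg g by apply: hs; rewrite mem_head.
have [|D [nD hD]] := IH; first by move=> x xs; apply: hs; rewrite inE xs orbT.
have [g0|gn0] := eqVneq g 0.
  exists D; split => // V h h0 hc; rewrite big_cons g0 h0 add0r; exact: hD.
(* Values at most [1/3], so that the two parts of [g] differ; all but finitely many [k] avoid
   [D]. *)
pose c k : R := k.+3%:R^-1.
have c0 k : 0 < c k by rewrite invr_gt0 ltr0n.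
have c1 k : c k <= 3^-1 by rewrite lef_pV2 ?posrE ?ltr0n // ler_nat.
have cinj : injective c.
  by move=> k l /invr_inj /eqP; rewrite eqr_nat => /eqP [].
have scinj (a b : R) : a *: g = b *: g -> a = b.
  move=> /eqP; rewrite -subr_eq0 -scalerBl scaler_eq0 (negbTE gn0) orbF subr_eq0.
  by move=> /eqP.
have [k [k1 k2]] : exists k, c k *: g \notin D /\ (1 - c k) *: g \notin D.
  apply: contrapT => hk; apply: infinite_nat.
  pose f1 k := c k *: g; pose f2 k := (1 - c k) *: g.
  apply: (@sub_finite_set _ _ (f1 @^-1` [set` D] `|` f2 @^-1` [set` D])).
    move=> k _; apply: contrapT => /not_orP [/= h1 h2]; apply: hk; exists k.
    by split; apply/negP.
  rewrite finite_setU; split; (apply: finite_preimage; last exact: finite_fset).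
  - by move=> a b _ _ /scinj /cinj.
  - by move=> a b _ _ /scinj h; apply: cinj; apply: oppr_inj; apply: (addrI 1).
have hc : 0 < c k < 1 by rewrite c0 (le_lt_trans (c1 k)) // invf_lt1 // ltr1n.
have ne : c k *: g != (1 - c k) *: g.
  by apply/negP => /eqP /scinj; have := c1 k; lra.
exists (c k *: g |` ((1 - c k) *: g |` D))%fset; split.
  move=> x; rewrite !inE => /orP[/eqP ->|/orP[/eqP ->|]]; last exact: nD.
    by apply: nonnegZ => //; exact: ltW.
  by apply: nonnegZ => //; case/andP: hc; lra.
move=> V h h0 hh; rewrite big_fsetU1 /=; last by rewrite !inE negb_or ne.
by rewrite big_fsetU1 //= big_cons (hD V h h0 hh) addrA -hh.
Qed.

End DistinctPartition.

(** * Entropy along Bernstein partitions *)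

Section Upper.
Context (R : realType) (B : comCStarAlgType R).
Local Notation C := (selfadj B).
Local Notation character := {lrmorphism C -> R | *%R}.
Implicit Types (f g : C) (chi : character).

(** The tangents at [kappa e^(- c_i)] add up to [ln kappa - mu F - 1 + m (T E) / kappa], where [E],
    the sum of the [e^(c_i) g_i], is close to [e^F]. The strict inequality [|T (expC F)| < kappa]
    pays for the approximation. *)
Lemma upper_partition (T : {linear C -> C}) (F : C) (mu : {scalar C}) (kappa : R) :
  (forall h, nonneg h -> nonneg (T h)) -> states mu -> `|T (expC F)| < kappa ->
  exists2 D : {fset C}, partition_of_unity D & forall m : {scalar C}, states m ->
    (\sum_(g <- D) (if mu g == 0%R then 0 else (mu g)%:E * lne (m (T g) / mu g)%:E)
      <= (ln kappa - mu F)%:E)%E.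
Proof.
move=> Tp [mup mu1] Tk; have k0 : 0 < kappa := le_lt_trans (normr_ge0 _) Tk.
(* Characters take [F] into [[-K, K]], so [t] is [F] rescaled to values in [[0, 1]]; the 1 in [K]
   avoids a division by 0. *)
pose K := `|F| + 1; pose b := 2 * K; pose a := - K.
have K0 : 0 < K by rewrite ltr_wpDl.
have b0 : 0 < b by rewrite mulr_gt0.
pose t := b^-1 *: (F - a%:A).
have tF : F = a%:A + b *: t by rewrite /t scalerA divff ?gt_eqF // scale1r; ring.
have ct chi : 0 <= chi t <= 1.
  rewrite /t scalarZ raddfB /= char_alg ler_pdivlMl // mulr0 ler_pdivrMl // mulr1.
  have := char_norm chi F; rewrite ler_norml /b /a /K => /andP[? ?].
  by apply/andP; split; lra.
(* The relative slack: [|T e^F| = kappa (1 - eta)]. The degree [N] is chosen to make the Bernstein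
   error at most [eta]. *)
clearbody t; pose eta := 1 - `|T (expC F)| / kappa.
have eta0 : 0 < eta by rewrite subr_gt0 ltr_pdivrMr // mul1r.
have [N N1 hN] : exists2 N, (0 < N)%N & b ^+ 2 * expR b / N%:R <= eta.
  exists (Num.bound (b ^+ 2 * expR b / eta)).+1 => //.
  rewrite ler_pdivrMr ?ltr0n // [eta * _]mulrC -ler_pdivrMr //.
  have q0 : 0 <= b ^+ 2 * expR b / eta.
    by rewrite divr_ge0 ?(ltW eta0) // mulr_ge0 ?expR_ge0 ?sqr_ge0.
  by apply: ltW; apply: lt_trans (archi_boundP q0) _; rewrite ltr_nat.
have N0 : 0 < N%:R :> R by rewrite ltr0n.
pose h := b / N%:R; pose g i := bernstein t N i; pose c (i : nat) := a + h * i%:R.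
have g0 i : (i <= N)%N -> nonneg (g i).
  move=> iN; apply/nonnegP => chi; rewrite /g /bernstein raddfMn /= rmorphM /=.
  rewrite !rmorphXn /= raddfB /= rmorph1; have /andP[t0 t1] := ct chi.
  by rewrite mulrn_wge0 // mulr_ge0 // exprn_ge0 // subr_ge0.
pose s := [seq g (val i) | i <- enum 'I_N.+1].
have s0 x : x \in s -> nonneg x.
  by move=> /mapP [i _ ->]; apply: g0; rewrite -ltnS; exact: (valP i).
have [D [nD hD]] := seq_to_fset s0.
have sumg : \sum_(i < N.+1) g i = 1 by exact: bernstein_sum.
have big_s (V : nmodType) (H : C -> V) :
    \sum_(x <- s) H x = \sum_(i < N.+1) H (g i).
  by rewrite big_map big_enum /=; apply: eq_bigl => i; rewrite inE.
exists D.
  split => //; rewrite (hD _ idfun) //; first by rewrite big_s.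
  by move=> x d _ _ /=; rewrite -scalerDl addrC subrK scale1r.
move=> m [mp m1].
pose H x : \bar R :=
  if mu x == 0%R then 0%E else ((mu x)%:E * lne (m (T x) / mu x)%:E)%E.
(* Entropy summands are homogeneous of degree 1, so splitting repeated terms keeps the sum. *)
have hom x (d : R) : nonneg x -> 0 < d < 1 ->
    (H x = H (d *: x) + H ((1 - d) *: x))%E.
  move=> nx /andP[d0 d1].
  have Hz e : 0 < e -> H (e *: x) = (e%:E * H x)%E.
    move=> e0; rewrite /H !linearZ /= mulf_eq0 gt_eqF //=.
    case: eqVneq => [_|xn]; first by rewrite mule0.
    rewrite EFinM -muleA; congr (_ * (_ * lne _%:E))%E.
    by field; rewrite xn gt_eqF.
  rewrite !Hz ?subr_gt0 // -ge0_muleDl ?lee_fin ?subr_ge0 ?(ltW d0) ?(ltW d1) //.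
  by rewrite -EFinD addrC subrK mul1e.
have -> : (\sum_(x <- D) (if mu x == 0%R then 0 else
    (mu x)%:E * lne (m (T x) / mu x)%:E) = \sum_(i < N.+1) H (g i))%E.
  by rewrite -big_s -(hD _ H) // /H raddf0 eqxx.
apply: (@le_trans _ _ (\sum_(i < N.+1)
  ((ln kappa) * mu (g i) - mu (g i) * c i + m (T (expR (c i) *: g i)) / kappa
    - mu (g i))%:E)%E).
  apply: lee_sum => i _; have ng : nonneg (g i) by apply: g0; rewrite -ltnS.
  have ap : 0 < kappa / expR (c i) by rewrite divr_gt0 // expR_gt0.
  apply: le_trans (summand_tangent (mup _ ng) (mp _ (Tp _ ng)) ap) _.
  rewrite lee_fin lnM ?posrE ?invr_gt0 ?expR_gt0 // lnV ?posrE ?expR_gt0 // expRK.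
  rewrite [T (_ *: _)]linearZ /= scalarZ le_eqVlt; apply/orP; left; apply/eqP.
  by field; rewrite !gt_eqF ?expR_gt0.
rewrite sumEFin lee_fin.
rewrite big_split /= sumrN big_split /= big_split /= sumrN -mulr_sumr.
have smu : \sum_(i < N.+1) mu (g i) = 1 by rewrite -raddf_sum sumg.
rewrite smu mulr1 -mulr_suml -!raddf_sum /=.
(* Bernstein polynomials reproduce affine functions, here [F = a + b t]. *)
have -> : \sum_(i < N.+1) mu (g i) * c i = mu F.
  rewrite tF raddfD /= scalarZ mu1 mulr1 scalarZ.
  under eq_bigr do rewrite /c mulrDr.
  rewrite big_split /= -mulr_suml smu mul1r; congr (_ + _).
  rewrite (_ : mu t = N%:R^-1 * mu (t *+ N)); last first.
    by rewrite raddfMn /= -[mu t *+ N]mulr_natl mulKf // gt_eqF.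
  rewrite -(bernstein_mean t N) raddf_sum /= mulrA mulr_sumr; apply: eq_bigr => i _.
  rewrite [mu (_ *+ _)]raddfMn /= -[mu _ *+ _]mulr_natl -/(g i) /h; ring.
set E := \sum_(i < N.+1) _.
suff : m (T E) / kappa <= 1 by lra.
rewrite ler_pdivrMr // mul1r.
have cE chi : chi E <= chi (expR eta *: expC F).
  rewrite [chi (_ *: _)]scalarZ /= char_expC -expRD.
  have -> : chi E = expR a * (1 - chi t + expR h * chi t) ^+ N.
    rewrite -(bernstein_gen (chi t)) raddf_sum /= mulr_sumr; apply: eq_bigr => i _.
    rewrite scalarZ /c expRD -mulrA expRM_natr; congr (_ * (_ * _)).
    by rewrite /g /bernstein raddfMn /= rmorphM /= !rmorphXn /= raddfB /= rmorph1.
  have N1' : 1 <= N%:R :> R by rewrite ler1n.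
  have hh := bernstein_exp_bound (ct chi) (ltW b0) N1'.
  rewrite -/h in hh.
  apply: (@le_trans _ _ (expR a * expR (b * chi t + b ^+ 2 * expR b / N%:R))).
    rewrite ler_wpM2l ?expR_ge0 //.
    have -> : b * chi t + b ^+ 2 * expR b / N%:R =
       (b * chi t + b ^+ 2 * expR b / N%:R) / N%:R * N%:R.
      by rewrite divfK // gt_eqF.
    rewrite expRM_natr; apply: lerXn2r; rewrite ?nnegrE ?expR_ge0 //.
      have /andP[t0 t1] := ct chi.
      by rewrite addr_ge0 ?subr_ge0 // mulr_ge0 ?expR_ge0.
  rewrite -expRD ler_expR tF raddfD /= char_alg scalarZ.
  lra.
pose k : {scalar C} := m \o T.
apply: (@le_trans _ _ (k (expR eta *: expC F))).
  by apply: (@functional_le _ _ k) => // x /Tp /mp.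
rewrite scalarZ /=.
have : m (T (expC F)) <= `|T (expC F)|.
  by apply: le_trans (ler_norm _) _; exact: state_norm.
have : `|T (expC F)| = kappa * (1 - eta).
  by rewrite /eta subKr mulrC divfK // gt_eqF.
move=> -> h1.
have h2 := expR_ge1Dx (- eta).
have h3 : expR eta * expR (- eta) = 1 by rewrite -expRD subrr expR0.
(* Since [1 - eta <= e^(- eta)], the slack cancels the factor [e^eta]. *)
apply: (@le_trans _ _ (expR eta * (kappa * expR (- eta)))).
  by rewrite ler_wpM2l ?expR_ge0 // (le_trans h1) // ler_wpM2l // ltW.
by rewrite mulrCA h3 mulr1.
Qed.

End Upper.

(** * Fekete's lemma *)

Section Fekete.
Context (R : realType).
Implicit Types (v : nat -> R).

Definition log_rate v (n : nat) : \bar R := ((n%:R^-1)%:E * lne (v n)%:E)%E.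

Lemma log_rate_le v n (c : R) : (0 < n)%N -> 0 <= v n ->
  (log_rate v n <= c%:E)%E = (v n <= expR (c * n%:R)).
Proof.
move=> n0 v0; have n0' : 0 < n%:R :> R by rewrite ltr0n.
have [E|vn0] := eqVneq (v n) 0.
  rewrite /log_rate E /lne lexx gt0_muleNy ?lte_fin ?invr_gt0 // leNye.
  by rewrite expR_ge0.
have vp : 0 < v n by rewrite lt_def vn0.
rewrite /log_rate lne_EFin // -EFinM lee_fin mulrC ler_pdivrMr //.
by rewrite -[ln _ <= _]ler_expR lnK ?posrE.
Qed.

Lemma log_rate_lty v n : (log_rate v n < +oo)%E.
Proof.
rewrite /log_rate /lne; case: ifP => _; last by rewrite -EFinM ltry.
have [->|n0] := posnP n; first by rewrite invr0 mul0e ltry.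
by rewrite gt0_muleNy ?lte_fin ?invr_gt0 ?ltr0n.
Qed.

(** Fekete's lemma in multiplicative form, admitting zero terms and the limit [-oo]. Division with
    remainder by [m] bounds the upper limit by the rate at [m]. *)
Lemma log_rate_cvg v : (forall n, 0 <= v n) ->
  (forall m n, v (m + n)%N <= v m * v n) ->
  log_rate v @ \oo --> ereal_inf [set log_rate v n | n in [set n | (0 < n)%N]].
Proof.
move=> v0 vM; set I := ereal_inf _.
(* Index 0 is absent from the infimum, so the sequence is shifted past it. *)
rewrite -cvg_shiftS; apply: limn_esup_le_cvg; last first.
  by move=> n; apply: ereal_inf_lbound; exists n.+1.
have key m (c c' : R) : (0 < m)%N -> (log_rate v m <= c'%:E)%E -> c' < c ->
    exists N, forall n, (N <= n)%N -> (log_rate v n.+1 <= c%:E)%E.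
  move=> m0; rewrite log_rate_le // => hm cc.
  (* [K] absorbs the terms [v r] at the remainders [r < m]. *)
  pose K : R := 1 + \sum_(r < m) v r * expR (- c' * r%:R).
  have K0 : 0 < K.
    by rewrite ltr_pwDl // sumr_ge0 // => r _; rewrite mulr_ge0 // expR_ge0.
  have vn n : v n <= K * expR (c' * n%:R).
    rewrite {1 2}(divn_eq n m).
    set q := (n %/ m)%N; pose r := Ordinal (ltn_pmod n m0).
    have hq : forall k, v (q * m + k)%N <= expR (c' * (q * m)%:R) * v k.
      elim: q => [|q IH] k; first by rewrite mul0n mulr0 expR0 mul1r.
      rewrite mulSn -addnA; apply: le_trans (vM _ _) _.
      apply: (@le_trans _ _ (expR (c' * m%:R) * (expR (c' * (q * m)%:R) * v k))).
        by apply: ler_pM.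
      by rewrite mulrA -expRD -mulrDr natrD.
    apply: le_trans (hq _) _; rewrite natrD mulrDr expRD mulrCA ler_pM2l ?expR_gt0 //.
    rewrite -ler_pdivrMr ?expR_gt0 // -expRN -mulNr.
    rewrite /K (bigD1 r) //= addrCA lerDl addr_ge0 // sumr_ge0 // => i _.
    by rewrite mulr_ge0 // expR_ge0.
  pose x := ln K / (c - c').
  exists (Num.bound `|x|) => n hn; rewrite log_rate_le //; apply: le_trans (vn _) _.
  rewrite -[K]lnK ?posrE // -expRD ler_expR.
  have : x <= n.+1%:R.
    apply: le_trans (ler_norm _) _; apply: ltW.
    apply: lt_le_trans (archi_boundP (normr_ge0 _)) _.
    by rewrite ler_nat; exact: leq_trans hn _.
  by rewrite /x ler_pdivrMr ?subr_gt0 //; lra.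
have esup (c : R) : (I < c%:E)%E ->
    (limn_esup (fun n => log_rate v n.+1) <= c%:E)%E.
  move=> /ereal_inf_lt [_ [m m0 <-] hm].
  have [c' hc' cc] : exists2 c' : R, (log_rate v m <= c'%:E)%E & c' < c.
    move: hm; case: (log_rate v m) => [r h|//|_]; first by exists r.
    by exists (c - 1); rewrite ?leNye //; lra.
  have [N hN] := key _ _ _ m0 hc' cc.
  rewrite limn_esup_lim (cvg_lim _ (@cvg_esups_inf _ _)) //.
  apply: le_trans (ereal_inf_lbound _) _; first by exists N.
  by apply: ge_ereal_sup => _ [n Nn <-]; exact: hN.
have Iy : (I < +oo)%E.
  by apply: le_lt_trans (log_rate_lty v 1); apply: ereal_inf_lbound; exists 1%N.
move: Iy esup; case: I => [r _ h|//|_ h].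
  by apply/lee_addgt0Pr => e e0; rewrite -EFinD; apply: h; rewrite lte_fin ltrDl.
case: limn_esup (h) => [r hr|hr|//].
  have h1 : (r%:E <= (r - 1)%:E)%E by apply: hr; exact: ltNyr.
  by move: h1; rewrite lee_fin leNgt ltrBlDr ltrDl ltr01.
by have : (+oo <= 0%:E :> \bar R)%E by apply: hr; exact: ltNyr.
Qed.

End Fekete.

(** * Iterates of weighted transfer operators *)

Section Dynamics.
Context (R : realType) (B : comCStarAlgType R).
Local Notation C := (selfadj B).
Local Notation character := {lrmorphism C -> R | *%R}.
Implicit Types (f g phi : C) (chi : character) (A : {linear C -> C})
  (delta : {lrmorphism C -> C}).

Lemma weighted_is_linear A phi : linear (weighted A phi).
Proof.
move=> a f g; rewrite /weighted -linearP; congr (A _).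
by rewrite mulrDr -scalerAr.
Qed.

Definition weightedL A phi : {linear C -> C} :=
  HB.pack (weighted A phi) (GRing.isLinear.Build R C C *:%R _ (weighted_is_linear A phi)).

Lemma weighted_transfer delta A phi :
  transfer_operator delta A -> transfer_operator delta (weightedL A phi).
Proof.
move=> [Ap At]; split => [f nf|f g].
  by apply: Ap; apply: nonnegM => //; exact: expC_nonneg.
by rewrite /= /weighted mulrCA At.
Qed.

Lemma transfer_iter delta A : transfer_operator delta A -> forall n f g,
  iter n A (iter n delta f * g) = f * iter n A g.
Proof.
move=> [_ At]; elim=> [//|n IH] f g.
by rewrite (iterSr n A) [iter n.+1 delta f]/= At IH -iterSr.
Qed.

Definition birkhoff delta phi n : C := \sum_(i < n) iter i delta phi.

Lemma iter_expC delta n f : iter n delta (expC f) = expC (iter n delta f).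
Proof. by elim: n => //= n ->; rewrite lrmorph_expC. Qed.

(** The transfer identity pulls each outer weight [e^phi] through [A^n], where it becomes
    [e^(delta^n phi)]; the exponents add up to the Birkhoff sum. *)
Lemma weighted_iter delta A phi n f : transfer_operator delta A ->
  iter n (weighted A phi) f = iter n A (expC (birkhoff delta phi n) * f).
Proof.
move=> hA; elim: n => [|n IH]; first by rewrite /= /birkhoff big_ord0 expC0 mul1r.
rewrite [LHS]iterS IH /weighted -(transfer_iter hA) iter_expC mulrA -expCD.
by rewrite -iterS /birkhoff big_ord_recr /= addrC.
Qed.

Lemma invariant_iter delta (mu : {scalar C}) n f :
  invariant_states delta mu -> mu (iter n delta f) = mu f.
Proof. by move=> [_ hi]; elim: n => //= n <-; rewrite hi. Qed.

Lemma invariant_birkhoff delta (mu : {scalar C}) phi n :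
  invariant_states delta mu -> mu (birkhoff delta phi n) = n%:R * mu phi.
Proof.
move=> hmu; rewrite raddf_sum /=.
under eq_bigr do rewrite (invariant_iter _ _ hmu).
by rewrite sumr_const card_ord mulr_natl.
Qed.

Lemma spectral_seqE A phi :
  spectral_seq A phi = log_rate (fun n => `|iter n (weighted A phi) 1|).
Proof. by []. Qed.

Lemma weighted_submul delta A phi m n : transfer_operator delta A ->
  `|iter (m + n) (weighted A phi) 1| <=
    `|iter m (weighted A phi) 1| * `|iter n (weighted A phi) 1|.
Proof.
move=> hA; have [Wp _] := weighted_transfer phi hA.
rewrite iterD mulrC -(powLE (weightedL A phi) m (iter n _ 1)).
rewrite -(powLE (weightedL A phi) m 1).
by apply: positive_norm => h nh; rewrite powLE; exact: iter_nonneg.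
Qed.

Lemma spectral_seq_cvg delta A phi : transfer_operator delta A ->
  spectral_seq A phi @ \oo -->
    ereal_inf [set spectral_seq A phi n | n in [set n | (0 < n)%N]].
Proof.
move=> hA; rewrite spectral_seqE; apply: log_rate_cvg => // m n.
exact: weighted_submul hA.
Qed.

Lemma tau_n_upper delta A phi (mu : {scalar C}) n (kappa : R) :
  transfer_operator delta A -> invariant_states delta mu ->
  `|iter n (weighted A phi) 1| < kappa ->
  (tau_n A n mu <= (ln kappa - n%:R * mu phi)%:E)%E.
Proof.
move=> hA hmu; rewrite (weighted_iter _ _ _ hA) mulr1 -powLE => hk.
have [|D pD hD] := @upper_partition _ _ (powL A n) _ mu _ _ (proj1 hmu) hk.
  by move=> h nh; rewrite powLE; apply: iter_nonneg => //; case: hA.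
apply: (@le_trans _ _ (tau_part A n mu D)).
  by apply: ereal_inf_lbound; exists D.
apply: ge_ereal_sup => _ [m sm <-]; rewrite -(invariant_birkhoff phi n hmu).
apply: le_trans (hD m sm); rewrite le_eqVlt; apply/orP; left; apply/eqP.
by apply: eq_bigr => g _; rewrite /tau_summand powLE.
Qed.

Lemma tau_upper delta A phi (mu : {scalar C}) n :
  transfer_operator delta A -> invariant_states delta mu -> (0 < n)%N ->
  ((mu phi)%:E + t_entropy A mu <= spectral_seq A phi n)%E.
Proof.
move=> hA hmu n0; have n0' : 0 < n%:R :> R by rewrite ltr0n.
apply: (@le_trans _ _ ((mu phi)%:E + (n%:R^-1)%:E * tau_n A n mu)%E).
  by rewrite leeD2l //; apply: ereal_inf_lbound; exists n.
set X := (_ + _)%E.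
have hX (kappa : R) : `|iter n (weighted A phi) 1| < kappa ->
    (X <= (ln kappa / n%:R)%:E)%E.
  move=> /(tau_n_upper hA hmu) h.
  apply: (@le_trans _ _ ((mu phi)%:E + (n%:R^-1)%:E * (ln kappa - n%:R * mu phi)%:E)%E).
    by rewrite leeD2l // lee_pmul2l // lte_fin invr_gt0.
  by rewrite -EFinM -EFinD lee_fin le_eqVlt; apply/orP; left; apply/eqP; field; rewrite gt_eqF.
(* Every real [c] above the spectral term gives an admissible [kappa = e^(c n)]; letting [c]
   decrease also treats the value [-oo]. *)
have hc (c : R) : (spectral_seq A phi n < c%:E)%E -> (X <= c%:E)%E.
  move=> hc; have [c' cc' hc'] : exists2 c' : R, c' < c & (spectral_seq A phi n <= c'%:E)%E.
    move: hc; case: (spectral_seq A phi n) => [r h|//|_]; first by exists r.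
    by exists (c - 1); rewrite ?leNye // ltrBlDr ltrDl.
  have := @hX (expR (c * n%:R)); rewrite expRK mulfK ?gt_eqF //; apply.
  move: hc'; rewrite spectral_seqE log_rate_le // => hc'.
  by apply: le_lt_trans hc' _; rewrite ltr_expR ltr_pM2r.
have : (spectral_seq A phi n < +oo)%E by rewrite spectral_seqE log_rate_lty.
move: hc; case: (spectral_seq A phi n) => [r h _|//|h _].
  by apply/lee_addgt0Pr => e e0; rewrite -EFinD; apply: h; rewrite lte_fin ltrDl.
case: (X) h => [r hr|hr|//].
  have h1 : (r%:E <= (r - 1)%:E)%E by apply: hr; exact: ltNyr.
  by move: h1; rewrite lee_fin leNgt ltrBlDr ltrDl ltr01.
by have : (+oo <= 0%:E :> \bar R)%E by apply: hr; exact: ltNyr.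
Qed.

End Dynamics.

(** * Attainment *)

Section UltraLimit.
Context (R : realType).

(** By compactness of [[-M, M]] the image of [U] has a cluster point, and an ultrafilter converges
    to its cluster points. *)
Lemma ultra_bounded_cvg (T : Type) (U : set_system T) (u : T -> R) (M : R) :
  UltraFilter U -> (forall n, `|u n| <= M) -> exists l : R, u @ U --> l.
Proof.
move=> uU uM; have pU : ProperFilter U by exact: ultra_proper.
have UA : U (u @^-1` [set` `[- M, M]]).
  apply: filterS (@filterT _ U _) => n _ /=; rewrite in_itv /=.
  by rewrite -ler_norml.
have [l [_ ul]] := @segment_compact R (- M) M (fmap u U) _ UA.
exists l => V Vl; have [//|h] := in_ultra_setVsetC (u @^-1` V) uU.
by have [x []] := ul (~` V) V h Vl.
Qed.

Lemma cvg_eventually (U : set_system nat) (u : nat -> R) (l : R) :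
  nbhs \oo `<=` U -> u @ \oo --> l -> u @ U --> l.
Proof. by move=> h ul V /ul; exact: h. Qed.

Lemma cvg_invn (K : R) : (fun N : nat => K / N%:R) @ \oo --> 0.
Proof.
rewrite -cvg_shiftS /=.
have : (fun n => K * harmonic n) @ \oo --> K * 0.
  by apply: cvgM; [exact: cvg_cst|exact: cvg_harmonic].
by rewrite mulr0.
Qed.

(** Disposes of the boundary terms of orbit averages, which are of order [1/N]. *)
Lemma cvg_close (U : set_system nat) (u v : nat -> R) (K l : R) :
  Filter U -> nbhs \oo `<=` U ->
  (exists N0, forall N, (N0 <= N)%N -> `|v N - u N| <= K / N%:R) ->
  u @ U --> l -> v @ U --> l.
Proof.
move=> fU hU [N0 h] ul.
rewrite (_ : v = (u \+ (v \- u))); last by apply/funext => n /=; ring.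
suff d0 : (v \- u) @ U --> 0.
  by rewrite -(addr0 l); exact: cvgD.
apply: cvg_eventually => //; apply/cvgrPdist_lt => e e0.
have [N1 _ h1] := (cvgrPdist_lt _ _).1 (@cvg_invn K) e e0.
exists (maxn N0 N1) => // N; rewrite /= geq_max => /andP[/h h2 /h1 h3].
rewrite sub0r normrN; apply: le_lt_trans h2 _.
by move: h3; rewrite sub0r normrN => /(le_lt_trans (ler_norm _)).
Qed.

Lemma ler_cvg_eventually (U : set_system nat) (u v : nat -> R) (l l' : R) :
  ProperFilter U -> nbhs \oo `<=` U -> u @ U --> l -> v @ U --> l' ->
  (exists N0, forall N, (N0 <= N)%N -> u N <= v N) -> l <= l'.
Proof.
move=> pU hU ul vl' [N0 h]; apply: (ler_cvg_to ul vl').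
by apply: hU; exists N0.
Qed.

End UltraLimit.

(** * Invariant states from orbit averages *)

Section InvariantLimit.
Context (R : realType) (B : comCStarAlgType R).
Local Notation C := (selfadj B).
Implicit Types (f g : C).

Lemma lrmorph_nonneg (delta : {lrmorphism C -> C}) f :
  nonneg f -> nonneg (delta f).
Proof. by move=> /nonneg_sqrt [s [-> _]]; rewrite rmorphXn; exact: sqr_nonneg. Qed.

Lemma lrmorph_norm (delta : {lrmorphism C -> C}) f : `|delta f| <= `|f|.
Proof.
apply: le_trans (positive_norm f (@lrmorph_nonneg delta)) _.
by rewrite /= rmorph1 selfadj_norm1 mulr1.
Qed.

(** A Krylov-Bogolyubov average in which the state changes together with the length of the orbit. *)
Definition orbit_average (delta : {lrmorphism C -> C}) (nu : nat -> {scalar C}) f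
  (N : nat) : R := N%:R^-1 * \sum_(i < N) nu N (iter i delta f).

Lemma iter_norm (delta : {lrmorphism C -> C}) i f : `|iter i delta f| <= `|f|.
Proof. by elim: i => //= i; apply: le_trans; exact: lrmorph_norm. Qed.

(** Krylov-Bogolyubov argument. A single ultrafilter provides the limits for all [f] at once, so
    linearity and positivity pass to the limit. *)
Lemma invariant_ultralimit (delta : {lrmorphism C -> C}) (nu : nat -> {scalar C}) :
  (forall N, states (nu N)) ->
  exists (U : set_system nat) (mu : {scalar C}), [/\ ProperFilter U,
    nbhs \oo `<=` U, invariant_states delta mu &
    forall f, orbit_average delta nu f @ U --> mu f].
Proof.
move=> snu; have [U [uU hU]] := ultraFilterLemma (@eventually_filter).
have pU : ProperFilter U by exact: ultra_proper.
have bound f N : `|orbit_average delta nu f N| <= `|f|.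
  rewrite /orbit_average normrM normfV normr_nat.
  have [->|N0] := posnP N; first by rewrite invr0 mul0r.
  rewrite mulrC ler_pdivrMr ?ltr0n //; apply: le_trans (ler_norm_sum _ _ _) _.
  rewrite mulr_natr -[N in leRHS]card_ord -sumr_const; apply: ler_sum => i _.
  by apply: le_trans (state_norm _ (snu N)) _; exact: iter_norm.
have [mu hmu] := choice (fun f => ultra_bounded_cvg uU (bound f)).
have uniq (u : nat -> R) (l l' : R) : u @ U --> l -> u @ U --> l' -> l = l'.
  by apply: cvg_unique; exact: norm_hausdorff.
have mul : scalar mu.
  move=> a f g; apply: (uniq _ _ _ (hmu _)).
  rewrite (_ : orbit_average _ _ _ = (fun N => a * orbit_average delta nu f N
     + orbit_average delta nu g N)).
    by apply: cvgD => //; apply: cvgM => //; exact: cvg_cst.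
  apply/funext => N; rewrite /orbit_average mulrCA -mulrDr [a * _]mulr_sumr -big_split /=.
  congr (_ * _); apply: eq_bigr => i _.
  by rewrite -powLRE !linearP /= !powLRE.
pose m : {scalar C} := HB.pack mu (GRing.isLinear.Build R C R *%R mu mul).
exists U, m; split => //.
split; first split.
- move=> f nf; apply: (ler_cvg_eventually pU hU (cvg_cst 0) (hmu f)).
  exists 0%N => N _; rewrite /orbit_average mulr_ge0 ?invr_ge0 // sumr_ge0 // => i _.
  have [h _] := snu N; apply: h; apply: iter_nonneg => //.
  exact: lrmorph_nonneg.
- apply: (uniq _ _ _ (hmu 1)); apply: (cvg_close (u := fun=> 1) (K := 0)) => //.
    exists 1%N => N N0; rewrite /orbit_average mul0r.
    rewrite (eq_bigr (fun=> 1)) => [|i _].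
      by rewrite sumr_const card_ord mulVf ?subrr ?normr0 // pnatr_eq0 -lt0n.
    by rewrite -powLRE rmorph1; have [_] := snu N.
  exact: cvg_cst.
- move=> f; apply: (uniq _ _ _ (hmu (delta f))).
  (* The averages of [delta f] and [f] differ by two end terms only. *)
  apply: (cvg_close (u := orbit_average delta nu f) (K := 2 * `|f|)) => //.
  exists 0%N => N _; rewrite /orbit_average -mulrBr.
  have -> k : \sum_(i < k) nu N (iter i delta (delta f)) -
      \sum_(i < k) nu N (iter i delta f) = nu N (iter k delta f) - nu N f.
    elim: k => [|k IH]; first by rewrite !big_ord0 /= !subrr.
    by rewrite !big_ord_recr /= -iterSr opprD addrACA IH /=; ring.
  rewrite normrM normfV normr_nat mulrC; apply: ler_wpM2r; first by rewrite invr_ge0.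
  apply: le_trans (ler_normB _ _) _.
  have := state_norm (iter N delta f) (snu N); have := state_norm f (snu N).
  by have := iter_norm delta N f; lra.
Qed.

End InvariantLimit.

(** * Tangents and telescoping sums *)

Section RealLemmas.
Context (R : realType).

(** The tangent bound for the logarithm at [y / (a (p + e))], multiplied by [p]; the regularization
    [e] allows [p = 0] and only lowers the term [y / a]. *)
Lemma entropy_tangent (p y a e : R) : 0 <= p -> 0 < y -> 0 < a -> 0 < e ->
  p * (ln y - ln (p + e)) <= p * (ln a - 1) + y / a.
Proof.
move=> p0 y0 a0 e0; have pe : 0 < p + e by rewrite ltr_wpDl.
have h : 0 < y / (a * (p + e)) by rewrite divr_gt0 // mulr_gt0.
have := ln_le_subr1 h; rewrite ln_div ?posrE ?mulr_gt0 // lnM ?posrE // => h1.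
have h2 : p * (y / (a * (p + e))) <= y / a.
  have -> : p * (y / (a * (p + e))) = y / a * (p / (p + e)) by field; rewrite !gt_eqF.
  by rewrite ler_piMr ?divr_ge0 ?(ltW y0) ?(ltW a0) // ler_pdivrMr // mul1r lerDl ltW.
have := ler_wpM2l p0 h1; nra.
Qed.

(** The convex function [x ln x] lies above its tangent at [b]. *)
Lemma xlnx_tangent (p b e : R) : 0 <= p -> 0 < b -> 0 <= e -> 0 < p + e ->
  p * (ln b + 1) - b <= p * ln (p + e).
Proof.
move=> p0 b0 e0 pe; have [->|pn0] := eqVneq p 0; first by rewrite !mul0r sub0r oppr_le0 ltW.
have pp : 0 < p by rewrite lt_def pn0.
have h := ln_le_subr1 (divr_gt0 b0 pp).
rewrite ln_div ?posrE // in h.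
have h2 : ln p <= ln (p + e) by rewrite ler_ln ?posrE // lerDl.
have h3 : p * (b / p - 1) = b - p by field.
have h4 := ler_wpM2l p0 h; have h5 := ler_wpM2l p0 h2; rewrite h3 in h4.
nra.
Qed.

Lemma le_eps_mul (x y c : R) : (forall e : R, 0 < e <= 1 -> x <= y + e * c) -> x <= y.
Proof.
move=> h; apply/ler_addgt0Pr => e e0.
pose d := Num.min 1 (e / (`|c| + 1)).
have c1 : 0 < `|c| + 1 by rewrite ltr_wpDl.
have d0 : 0 < d by rewrite lt_min ltr01 divr_gt0.
have d1 : d <= 1 by rewrite ge_min lexx.
have d2 : d * (`|c| + 1) <= e by rewrite -ler_pdivlMr // ge_min lexx orbT.
have := h d; rewrite d0 d1 => /(_ isT) h1; apply: le_trans h1 _; rewrite lerD2l.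
by apply: le_trans d2; rewrite ler_pM2l //; have := ler_norm c; lra.
Qed.

Lemma shift_telescope (Phi : nat -> R) M n :
  \sum_(i < M) (Phi (i + n)%N - Phi i) =
  \sum_(i < n) Phi (M + i)%N - \sum_(i < n) Phi i.
Proof.
elim: M => [|M IH]; first by rewrite big_ord0 subrr.
rewrite big_ord_recr /= IH.
have E : \sum_(i < n) Phi (M.+1 + i)%N + Phi M = \sum_(i < n) Phi (M + i)%N + Phi (M + n)%N.
  rewrite -[RHS](big_ord_recr n (fun i => Phi (M + i)%N)) /= big_ord_recl addn0 addrC.
  by congr (_ + _); apply: eq_bigr => i _; rewrite /= /bump add1n addSnnS.
by move: E; lra.
Qed.

(* Converse of [summand_tangent]: the summands are infima of their tangents. *)
Lemma sum_tangent_inf (T : eqType) (s : seq T) (x y : T -> R) (c : R) :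
  (forall g, g \in s -> 0 <= x g) -> (forall g, g \in s -> 0 <= y g) ->
  (forall a : T -> R, (forall g, 0 < a g) ->
     c <= \sum_(g <- s) (x g * (ln (a g) - 1) + y g / a g)) ->
  (c%:E <= \sum_(g <- s) (if x g == 0%R then 0 else (x g)%:E * lne (y g / x g)%:E))%E.
Proof.
move=> x0 y0 h.
pose v g := if (x g == 0) || (y g == 0) then 0 else x g * ln (y g / x g).
pose w g := if y g == 0 then x g else 0.
have key (t d : R) : 0 < d ->
    c <= \sum_(g <- s) v g + d * (size s)%:R - t * \sum_(g <- s) w g.
  (* If [x] and [y] are nonzero, [a = y / x] is optimal; if [x = 0], a large [a] leaves at most [d];
     if only [y = 0], the value [e^(-t)] yields a multiple of [-t]. Absolute values keep [a]
     positive off [s]. *)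
  move=> d0; pose a g := if x g == 0 then (`|y g| + 1) / d
    else if y g == 0 then expR (- t) else `|y g| / `|x g|.
  have a0 g : 0 < a g.
    rewrite /a; case: eqVneq => [_|xn]; first by rewrite divr_gt0 // ltr_wpDl.
    case: eqVneq => [_|yn]; first exact: expR_gt0.
    by rewrite divr_gt0 // normr_gt0.
  apply: le_trans (h a a0) _.
  have -> : d * (size s)%:R = \sum_(g <- s) d.
    by rewrite big_const_seq count_predT iter_addr_0 mulr_natr.
  rewrite mulr_sumr -sumrN -!big_split /= big_seq_cond [leRHS]big_seq_cond.
  apply: ler_sum => g; rewrite andbT => gs.
  have xg := x0 g gs; have yg := y0 g gs.
  rewrite /v /w /a; case: eqVneq => [->|xn] /=.
    rewrite mul0r add0r if_same mulr0 subr0 add0r invf_div mulrCA ler_piMr ?(ltW d0) //.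
    rewrite ger0_norm // ler_pdivrMr ?ltr_wpDl // mul1r; lra.
  case: eqVneq => [->|yn].
    rewrite mul0r expRK; nra.
  rewrite !ger0_norm // invf_div mulr0 subr0 [y g * _]mulrC divfK //; lra.
have w0 g : g \in s -> 0 <= w g by move=> gs; rewrite /w; case: ifP => // _; exact: x0.
(* A summand equal to [-oo] would have [x > 0] and [y = 0]; a large [t] then contradicts [key]. *)
have W0 : \sum_(g <- s) w g = 0.
  apply/eqP/negPn/negP => Wn.
  have Wp : 0 < \sum_(g <- s) w g.
    by rewrite lt_def Wn big_seq_cond sumr_ge0 // => g; rewrite andbT; exact: w0.
  have := key ((\sum_(g <- s) v g + 1 * (size s)%:R - c + 1) / \sum_(g <- s) w g) 1 ltr01.
  by rewrite divfK //; lra.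
have wg g : g \in s -> w g = 0.
  move=> gs; apply/eqP; rewrite eq_le w0 // andbT -W0 (big_rem g gs) /= lerDl.
  by rewrite big_seq_cond sumr_ge0 // => k; rewrite andbT => /mem_rem; exact: w0.
have cv : c <= \sum_(g <- s) v g.
  apply: (@le_eps_mul _ _ (size s)%:R) => e /andP[e0 _].
  by have := key 0 e e0; rewrite mul0r subr0.
apply: (@le_trans _ _ (\sum_(g <- s) (v g)%:E)%E); first by rewrite sumEFin lee_fin.
rewrite le_eqVlt; apply/orP; left; apply/eqP.
apply: eq_big_seq => g gs; rewrite /v; case: eqVneq => [//|xn]; rewrite orFb.
have yn : y g != 0.
  by apply/eqP => yg; move: (wg g gs) xn; rewrite /w yg eqxx => -> /eqP.
rewrite (negbTE yn) lne_EFin ?EFinM // divr_gt0 // lt_def ?yn ?xn /=.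
  exact: y0.
exact: x0.
Qed.

End RealLemmas.

(** * One step of the entropy estimate *)

Section EntropyStep.
Context (R : realType) (B : comCStarAlgType R).
Local Notation C := (selfadj B).
Local Notation character := {lrmorphism C -> R | *%R}.
Implicit Types (f g p q F : C) (chi : character).

(** At each character, apply [entropy_tangent] with [y = e^(-F) (q + e)], weight by [g] and sum over
    the partition; the left side is unchanged because the weights add up to 1, and the [e] in [y]
    causes the last sum. *)
Lemma entropy_step (kappa : {scalar C}) p q F Lp Lq (D : {fset C}) (a : C -> R) (e : R) :
  (forall h, nonneg h -> 0 <= kappa h) -> nonneg p -> nonneg q ->
  partition_of_unity D -> (forall g, 0 < a g) -> 0 < e ->
  (forall chi, chi Lp = ln (chi p + e)) -> (forall chi, chi Lq = ln (chi q + e)) ->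
  kappa (p * (Lq - F - Lp)) <=
  \sum_(g <- D) (kappa (g * p) * (ln (a g) - 1) + kappa (g * expC (- F) * q) / a g)
   + e * \sum_(g <- D) kappa (g * expC (- F)) / a g.
Proof.
move=> kp np nq [nD sD] a0 e0 hLp hLq.
pose G := \sum_(g <- D) ((ln (a g) - 1) *: (g * p) +
  (a g)^-1 *: (g * expC (- F) * q + e *: (g * expC (- F)))).
apply: (@le_trans _ _ (kappa G)); last first.
  rewrite /G raddf_sum /= mulr_sumr -big_split /= le_eqVlt; apply/orP; left.
  apply/eqP/eq_bigr => g _.
  by rewrite raddfD /= !scalarZ raddfD /= scalarZ; ring.
apply: functional_le => // chi.
have -> : chi (p * (Lq - F - Lp)) =
    \sum_(g <- D) chi g * (chi p * (chi Lq - chi F - chi Lp)).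
  by rewrite -mulr_suml -raddf_sum /= sD [chi 1]rmorph1 mul1r rmorphM /= !raddfB.
rewrite /G raddf_sum /= big_seq_cond [leRHS]big_seq_cond; apply: ler_sum => g.
rewrite andbT => /nD /(char_ge0 chi) g0.
have cp := char_ge0 chi np; have cq := char_ge0 chi nq.
rewrite raddfD /= !scalarZ /= raddfD /= scalarZ !rmorphM /= char_expC raddfN /=.
have y0 : 0 < expR (- chi F) * (chi q + e) by rewrite mulr_gt0 ?expR_gt0 // ltr_wpDl.
have h := entropy_tangent cp y0 (a0 g) e0.
rewrite lnM ?posrE ?expR_gt0 ?ltr_wpDl // expRK in h.
rewrite hLp hLq; have := ler_wpM2l g0 h.
rewrite (addrC (- chi F)) => /le_trans; apply; rewrite le_eqVlt; apply/orP; left.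
by apply/eqP; ring.
Qed.

End EntropyStep.

(** * Iterated states and their orbit sums *)

Section IteratedStates.
Context (R : realType) (B : comCStarAlgType R).
Local Notation C := (selfadj B).
Local Notation character := {lrmorphism C -> R | *%R}.
Context (delta : {lrmorphism C -> C}) (A : {linear C -> C}) (phi : C).
Context (hA : transfer_operator delta A).
Implicit Types (f g : C) (chi m : character).

Let W := weightedL A phi.
Let h i : C := iter i W 1.

Lemma iter_weighted_nonneg i : nonneg (h i).
Proof.
have [Wp _] := weighted_transfer phi hA.
by apply: iter_nonneg => //; exact: nonneg1.
Qed.

(** For [0 < m (h N)] and [i <= N], the state [nu_N o delta^i] has density [h i] with respect to
    this functional; [i = 0] gives [nu_N] itself. *)
Definition backward m N i f : R := m (iter (N - i) W f) / m (h N).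

Lemma backward_scalar m N i : scalar (backward m N i).
Proof.
move=> a f g; rewrite /backward -!powLE linearP linearP /= mulrDl.
by rewrite mulrA.
Qed.

Definition backwardL m N i : {scalar C} :=
  HB.pack (backward m N i) (GRing.isLinear.Build R C R *%R _ (backward_scalar m N i)).

Lemma backward_ge0 m N i f : nonneg f -> 0 <= backwardL m N i f.
Proof.
have [Wp _] := weighted_transfer phi hA.
move=> nf; rewrite /= /backward divr_ge0 ?char_ge0 //; last exact: iter_weighted_nonneg.
exact: iter_nonneg.
Qed.

Definition iterated_state m N : {scalar C} := backwardL m N 0.

Lemma iterated_state_state m N : 0 < m (h N) -> states (iterated_state m N).
Proof.
move=> Z0; split; first by move=> f; exact: backward_ge0.
by rewrite /= /backward subn0 divff // gt_eqF.
Qed.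

(** The transfer identity for the innermost [i] factors: [W^N (delta^i f) = W^(N-i) (f h_i)]. *)
Lemma backward_h m N i f : (i <= N)%N ->
  backwardL m N i (f * h i) = iterated_state m N (iter i delta f).
Proof.
move=> iN; have hW := weighted_transfer phi hA.
have E : iter N W (iter i delta f) = iter (N - i) W (f * h i).
  by rewrite -{1}(subnK iN) iterD -[iter i delta f]mulr1 (transfer_iter hW).
by rewrite /= /backward subn0 E.
Qed.

(** Split [W^(N-i)] as [W^(N-i-n) W^n]: the factor [e^(-S_n)] cancels the weight of [W^n], leaving
    [A^n g], and the transfer identity extracts [h (i + n)]. *)
Lemma backward_shift m N n i g : (i + n <= N)%N ->
  backwardL m N i (g * expC (- birkhoff delta phi n) * iter n delta (h (i + n))) =
  iterated_state m N (iter (i + n) delta (iter n A g)).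
Proof.
move=> iN; have hW := weighted_transfer phi hA.
rewrite -(backward_h m _ iN) [_ * iter n delta _]mulrC /= /backward.
rewrite (_ : N - i = (N - (i + n)) + n)%N; last first.
  by rewrite subnDA subnK // leq_subRL ?(leq_trans _ iN) ?leq_addr.
rewrite iterD (transfer_iter hW) (weighted_iter phi n _ hA).
by rewrite mulrCA -expCD subrr expC0 mulr1; rewrite [_ * h _]mulrC.
Qed.

(* [iterated_state m N (iter j delta L_j)], for [L_j] the logarithm of
   [h j + e], telescopes along [j]; only its first and last [n] values remain. *)
Lemma entropy_sum_bound n (D : {fset C}) (a : C -> R) :
  partition_of_unity D -> (forall g, 0 < a g) ->
  exists K : R, forall m M, let N := (M + n)%N in 0 < m (h N) ->
   n%:R * ln (m (h N)) - K <=
   \sum_(i < M) iterated_state m N (iter i delta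
      (birkhoff delta phi n + \sum_(g <- D) (ln (a g) - 1) *: g)) +
   \sum_(i < M) iterated_state m N (iter (i + n) delta
      (\sum_(g <- D) (a g)^-1 *: iter n A g)).
Proof.
move=> pD a0; pose S := 1 + \sum_(r < n.+1) `|h r|.
have S0 : 0 < S by rewrite ltr_pwDl // sumr_ge0.
exists (n%:R * ln S + \sum_(i < n) ln (`|h i| + 1)) => m M N Z0.
set F := birkhoff delta phi n; set nu := iterated_state m N.
have snu : states nu by exact: iterated_state_state.
pose Z := m (h N).
set P := \sum_(g <- D) _ *: g; set Q := \sum_(g <- D) _ *: iter n A g.
pose ck i := \sum_(g <- D) backwardL m N i (g * expC (- F)) / a g.
apply: (@le_eps_mul _ _ _ (\sum_(i < M) ck i)) => e /andP[e0 e1].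
have [L hL] : exists L : nat -> C, forall j chi, chi (L j) = ln (chi (h j) + e).
  have hj j : exists L, forall chi, chi L = ln (chi (h j) + e).
    have [|L hL] := @exists_ln R B (h j + e%:A) e e0.
      by move=> chi; rewrite raddfD /= char_alg lerDr; exact: char_ge0 (iter_weighted_nonneg j).
    by exists L => chi; rewrite hL raddfD /= char_alg.
  by have [L hL] := choice hj; exists L.
pose Phi j := nu (iter j delta (L j)).
have nuS k (G : C -> C) :
    nu (iter k delta (\sum_(g <- D) G g)) = \sum_(g <- D) nu (iter k delta (G g)).
  rewrite -powLRE raddf_sum raddf_sum; apply: eq_bigr => g _.
  by rewrite -powLRE.
have nuZ k c f : nu (iter k delta (c *: f)) = c * nu (iter k delta f).
  rewrite -!powLRE -scalarZ; congr (nu _); exact: linearZ.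
(* [entropy_step] for the functional at time [i], with [p = h_i] and [q = delta^n h_(i+n)],
   rewritten in terms of [nu]. *)
have step (i : nat) : (i + n <= N)%N -> Phi (i + n)%N - Phi i <=
    nu (iter i delta (F + P)) + nu (iter (i + n) delta Q) + e * ck i.
  move=> iN; have iN' : (i <= N)%N by apply: leq_trans iN; exact: leq_addr.
  have := @entropy_step _ _ (backwardL m N i) (h i) (iter n delta (h (i + n))) F
    (L i) (iter n delta (L (i + n))) D a e (@backward_ge0 m N i) (iter_weighted_nonneg i) _ pD a0 e0
    (hL i) _.
  have nq : nonneg (iter n delta (h (i + n))).
    by apply: iter_nonneg; [exact: lrmorph_nonneg|exact: iter_weighted_nonneg].
  have cq chi : chi (iter n delta (L (i + n))) =
      ln (chi (iter n delta (h (i + n))) + e).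
    rewrite -!powLRE; exact: (hL _ (chi \o powLR delta n : character)).
  move=> /(_ nq cq); rewrite mulrC backward_h // -/nu.
  have -> : nu (iter i delta (iter n delta (L (i + n)) - F - L i)) =
      Phi (i + n)%N - nu (iter i delta F) - Phi i.
    by rewrite /Phi iterD -!powLRE !raddfB.
  have -> : \sum_(g <- D) (backwardL m N i (g * h i) * (ln (a g) - 1) +
      backwardL m N i (g * expC (- F) * iter n delta (h (i + n))) / a g) =
      nu (iter i delta P) + nu (iter (i + n) delta Q).
    rewrite big_split; congr (_ + _).
      rewrite /P nuS; apply: eq_bigr => g _.
      by rewrite nuZ -(backward_h m g iN') mulrC.
    rewrite /Q nuS; apply: eq_bigr => g _.
    by rewrite nuZ -(backward_shift m g iN) mulrC.
  rewrite -/(ck i).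
  have -> : nu (iter i delta (F + P)) = nu (iter i delta F) + nu (iter i delta P).
    by rewrite -!powLRE !raddfD.
  lra.
have PhiU j : Phi j <= ln (`|h j| + 1).
  have [np n1] := snu.
  apply: (@le_trans _ _ (nu (ln (`|h j| + 1))%:A)); last first.
    by rewrite scalarZ n1 mulr1.
  apply: functional_le => // chi; rewrite char_alg -powLRE.
  have := hL j (chi \o powLR delta j : character) => /= ->.
  set c := (X in ln X <= _).
  have c0 : e <= c.
    rewrite lerDr.
    exact: (char_ge0 (chi \o powLR delta j : character) (iter_weighted_nonneg j)).
  have c1 : c <= `|h j| + 1.
    apply: lerD => //; apply: le_trans (ler_norm _) _.
    exact: (char_norm (chi \o powLR delta j : character)).
  have cp := lt_le_trans e0 c0.
  by rewrite ler_ln ?posrE // (lt_le_trans cp).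
(* Tangent to [x ln x] at [b = Z / S]: the functional is 1 on [h j] and [m (h (N - j)) / Z <= S / Z]
   on the identity, so the two constants of the tangent compensate. *)
have PhiL j : (j <= N)%N -> (N - j <= n)%N -> ln Z - ln S <= Phi j.
  move=> jN Nj; rewrite /Phi -(backward_h m _ jN).
  have b0 : 0 < Z / S by rewrite divr_gt0.
  apply: (@le_trans _ _ (backwardL m N j ((ln (Z / S) + 1) *: h j - (Z / S)%:A))).
    set kb := backwardL m N j.
    have kbB f g : kb (f - g) = kb f - kb g by exact: raddfB.
    rewrite kbB !scalarZ.
    have -> : kb (h j) = 1.
      by rewrite -[h j]mul1r backward_h // -powLRE rmorph1; case: snu.
    have -> : kb 1 = m (h (N - j)) / Z by [].
    have hS : m (h (N - j)) <= S.
      apply: le_trans (ler_norm _) _; apply: le_trans (char_norm _ _) _.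
      have jn : (N - j < n.+1)%N by rewrite ltnS.
      rewrite /S (bigD1 (Ordinal jn)) //= addrCA lerDl addr_ge0 // sumr_ge0 //.
    rewrite ln_div ?posrE //.
    have -> : Z / S * (m (h (N - j)) / Z) = m (h (N - j)) / S.
      by field; rewrite !gt_eqF.
    have : m (h (N - j)) / S <= 1 by rewrite ler_pdivrMr // mul1r.
    lra.
  apply: functional_le => [|chi]; first exact: backward_ge0.
  rewrite raddfB /= !scalarZ /= rmorph1 mulr1 rmorphM /= hL mulrC [leRHS]mulrC.
  have c0 := char_ge0 chi (iter_weighted_nonneg j).
  by apply: xlnx_tangent => //; [exact: ltW|rewrite ltr_wpDl].
have T := shift_telescope Phi M n.
have U1 : \sum_(i < n) Phi i <= \sum_(i < n) ln (`|h i| + 1).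
  by apply: ler_sum => i _; exact: PhiU.
have U2 : n%:R * (ln Z - ln S) <= \sum_(i < n) Phi (M + i)%N.
  rewrite mulr_natl -[n in X in X <= _]card_ord -sumr_const; apply: ler_sum => i _.
  apply: PhiL; first by rewrite leq_add2l ltnW.
  by rewrite /N subnDl leq_subr.
have U3 : \sum_(i < n) Phi (M + i)%N - \sum_(i < n) Phi i <=
    \sum_(i < M) nu (iter i delta (F + P)) +
    \sum_(i < M) nu (iter (i + n) delta Q) + e * \sum_(i < M) ck i.
  rewrite -T mulr_sumr -!big_split; apply: ler_sum => i _; apply: step.
  by rewrite leq_add2r ltnW.
rewrite -/Z; lra.
Qed.

End IteratedStates.

(** * The maximizing state *)

Section LowerBound.
Context (R : realType) (B : comCStarAlgType R).
Local Notation C := (selfadj B).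
Local Notation character := {lrmorphism C -> R | *%R}.
Context (delta : {lrmorphism C -> C}) (A : {linear C -> C}) (phi : C).
Context (hA : transfer_operator delta A).

(** Dropping [n] terms and shifting by [k] leaves at most [n + 2 k] boundary terms, each bounded by
    [|f|]. *)
Lemma orbit_average_shift (U : set_system nat) (nu : nat -> {scalar C})
    (mu : C -> R) (f : C) (k n : nat) :
  ProperFilter U -> nbhs \oo `<=` U -> (forall N, states (nu N)) ->
  orbit_average delta nu f @ U --> mu f ->
  (fun N => N%:R^-1 * \sum_(i < N - n) nu N (iter (i + k) delta f)) @ U --> mu f.
Proof.
move=> pU hU snu; apply: (@cvg_close _ _ _ _ ((n + k + k)%:R * `|f|)) => //.
exists n => N nN; rewrite /orbit_average -mulrBr normrM normfV normr_nat mulrC.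
apply: ler_wpM2r; first by rewrite invr_ge0.
pose M := (N - n)%N.
pose x i := nu N (iter i delta f).
have xf i : `|x i| <= `|f|.
  by apply: le_trans (state_norm _ (snu N)) _; exact: iter_norm.
have sx p q : `|\sum_(i < p) x (q + i)%N| <= p%:R * `|f|.
  apply: le_trans (ler_norm_sum _ _ _) _.
  by rewrite mulr_natl -[p in leRHS]card_ord -sumr_const; apply: ler_sum => i _.
have E : \sum_(i < M) x (i + k)%N - \sum_(i < M + n) x i =
    \sum_(i < k) x (M + i)%N - \sum_(i < k) x (0 + i)%N - \sum_(i < n) x (M + i)%N.
  have := shift_telescope x M k; rewrite sumrB => <-.
  by rewrite big_split_ord /=; ring.
have E2 : \sum_(i < M + n) x i = \sum_(i < N) x i by rewrite /M subnK.
rewrite -[X in `|_ - X|]E2 -[X in `|X - _|]/(\sum_(i < M) x (i + k)%N).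
rewrite E; apply: le_trans (ler_normB _ _) _.
have := ler_normB (\sum_(i < k) x (M + i)%N) (\sum_(i < k) x (0 + i)%N).
by have := sx k M; have := sx k 0%N; have := sx n M; rewrite !natrD; lra.
Qed.

(** Serves the case of spectral potential [-oo], where the upper bound makes every invariant state
    maximizing. *)
Lemma exists_invariant_state : exists mu, invariant_states delta mu.
Proof.
have [chi _] := exists_character B.
have [U [mu [_ _ hmu _]]] :=
  @invariant_ultralimit _ _ delta (fun=> chi : {scalar C}) (fun=> character_state chi).
by exists mu.
Qed.

Lemma exists_entropy_lower (l : R) :
  (forall n, (0 < n)%N -> (l%:E <= spectral_seq A phi n)%E) ->
  exists2 mu, invariant_states delta mu & (l%:E <= (mu phi)%:E + t_entropy A mu)%E.
Proof.
move=> hl; pose h i := iter i (weighted A phi) 1.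
(* As [l] is a real number, no [h n] can vanish. *)
have hv n : 0 < `|h n| /\ n%:R * l <= ln `|h n|.
  have [->|n0] := posnP n; first by rewrite /h /= selfadj_norm1 mul0r ln1.
  have n0' : 0 < n%:R :> R by rewrite ltr0n.
  have := hl n n0; rewrite /spectral_seq -/(h n).
  have [->|hn] := eqVneq `|h n| 0.
    by rewrite /lne lexx gt0_muleNy ?lte_fin ?invr_gt0 // leeNy_eq.
  have hp : 0 < `|h n| by rewrite lt_def hn normr_ge0.
  by rewrite lne_EFin // -EFinM lee_fin mulrC ler_pdivlMr // mulrC.
(* The factor [1/2] allows a strict inequality; it costs [ln 2], which disappears after division by
   [N]. *)
have hm0 N : exists chi : character, `|h N| / 2 < chi (h N).
  apply: char_lt_norm; first exact: (iter_weighted_nonneg phi hA).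
    by rewrite divr_ge0.
  by have [] := hv N; lra.
have [m hm] := choice hm0.
have Zp N : 0 < m N (h N) by apply: le_lt_trans (hm N); rewrite divr_ge0.
pose nu N := iterated_state A phi (m N) N.
have snu N : states (nu N) by apply: (iterated_state_state hA); exact: Zp.
have [U [mu [pU hU imu cmu]]] := invariant_ultralimit delta snu.
exists mu => //; case: (imu) => -[mup mu1] _.
suff main n : (0 < n)%N -> ((n%:R * (l - mu phi))%:E <= tau_n A n mu)%E.
  rewrite -leeBlDl // -EFinB; apply: le_ereal_inf_tmp => _ [n n0 <-].
  have n0' : 0 < n%:R :> R by rewrite ltr0n.
  have nn : n%:R != 0 :> R by rewrite gt_eqF.
  rewrite -[X in (X%:E <= _)%E](mulKf nn) EFinM.
  by rewrite lee_pmul2l ?lte_fin ?invr_gt0 //; exact: main.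
move=> n0; apply: le_ereal_inf_tmp => _ [D pD <-].
apply: (@le_trans _ _ (\sum_(g <- D) tau_summand A n mu mu g)%E); last first.
  by apply: ereal_sup_ubound; exists mu => //; case: imu.
apply: sum_tangent_inf => [g /pD.1 /mup //|g /pD.1 ng|a a0].
  by apply: mup; apply: iter_nonneg => //; case: hA.
have [K hK] := entropy_sum_bound phi hA n pD a0.
set X := birkhoff delta phi n + _ in hK; set Y := \sum_(g <- D) _ *: iter n A g in hK.
(* With [M = N - n], the shifts 0 and [n] are those of the two sums in [hK]. *)
have cX := @orbit_average_shift U nu mu X 0 n pU hU snu (cmu X).
have cY := @orbit_average_shift U nu mu Y n n pU hU snu (cmu Y).
have key : n%:R * l <= mu X + mu Y.
  (* The total loss: [n ln 2] from the choice of [m] and [K] from the ends of the telescoping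
     sum. *)
  pose c := n%:R * ln 2 + K.
  have cl : (fun N => n%:R * l - c / N%:R) @ U --> n%:R * l.
    apply: (cvg_close (u := fun=> n%:R * l) (K := `|c|)) => //; last exact: cvg_cst.
    exists 0%N => N _.
    by rewrite addrAC subrr add0r normrN normrM normfV normr_nat.
  apply: (ler_cvg_eventually pU hU cl (cvgD cX cY)).
  exists n => N nN; have N0 : 0 < N%:R :> R by rewrite ltr0n (leq_trans n0).
  have := hK (m N) (N - n)%N; rewrite subnK // -/(h N) => /(_ (Zp N)) hN.
  have lZ : N%:R * l - ln 2 <= ln (m N (h N)).
    have [v0 vl] := hv N; apply: le_trans (lerB vl (lexx _)) _.
    by rewrite -ln_div ?posrE // ler_ln ?posrE ?divr_gt0 // ltW.
  have -> : n%:R * l - c / N%:R = N%:R^-1 * (n%:R * (N%:R * l - ln 2) - K).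
    by rewrite /c; field; rewrite gt_eqF.
  rewrite /GRing.add_fun /= -mulrDr ler_pM2l ?invr_gt0 //.
  under [X in _ <= X + _]eq_bigr do rewrite addn0.
  by apply: le_trans hN; rewrite lerB // ler_wpM2l.
have muS (G : C -> C) : mu (\sum_(g <- D) G g) = \sum_(g <- D) mu (G g).
  exact: raddf_sum.
have EX : mu X = n%:R * mu phi + \sum_(g <- D) mu g * (ln (a g) - 1).
  rewrite /X raddfD /= (invariant_birkhoff phi n imu) muS; congr (_ + _).
  by apply: eq_bigr => g _; rewrite scalarZ mulrC.
have EY : mu Y = \sum_(g <- D) mu (iter n A g) / a g.
  by rewrite /Y muS; apply: eq_bigr => g _; rewrite scalarZ mulrC.
by rewrite big_split /=; move: key; rewrite EX EY; lra.
Qed.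

End LowerBound.

(** * The variational principle *)

Theorem theorem6p10 (R : realType) (B : comCStarAlgType R)
    (delta : {lrmorphism selfadj B -> selfadj B})
    (A : {linear selfadj B -> selfadj B})
    (hA : transfer_operator delta A) (phi : selfadj B) :
  cvgn (spectral_seq A phi) /\
  is_max [set ((mu phi)%:E + t_entropy A mu)%E | mu in invariant_states delta]
    (spectral_potential A phi).
Proof.
have cv := @spectral_seq_cvg _ _ delta A phi hA; split; first by apply/cvg_ex; eexists; exact: cv.
rewrite /spectral_potential (cvg_lim _ cv) //; set I := ereal_inf _ in cv *.
have upper mu : invariant_states delta mu -> ((mu phi)%:E + t_entropy A mu <= I)%E.
  by move=> hmu; apply: le_ereal_inf_tmp => _ [n n0 <-]; exact: tau_upper hA hmu n0.
split; last by move=> _ [mu hmu <-]; exact: upper.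
have Iy : (I < +oo)%E.
  apply: le_lt_trans (log_rate_lty (fun n => `|iter n (weighted A phi) 1|) 1).
  by apply: ereal_inf_lbound; exists 1%N.
suff [mu hmu h] : exists2 mu, invariant_states delta mu &
    (I <= (mu phi)%:E + t_entropy A mu)%E.
  by exists mu => //; apply/le_anti; rewrite h upper.
(* A real infimum is attained through the limit state; for [-oo] any invariant state will do. *)
case E : I Iy => [l| |] // _; last first.
  by have [mu hmu] := exists_invariant_state delta; exists mu => //; exact: leNye.
apply: (exists_entropy_lower hA) => n n0; rewrite -E.
by apply: ereal_inf_lbound; exists n.
Qed.
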